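(* Let $a,b,c$ be positive integers, $\rho=(a^b)$ and $N=b+c$. Let $T$ be a uniformly random lozenge tiling of the hexagon with sides $(a,b,c,a,b,c)$ and let $\Gamma_\ell$ be the number of left corners of $T$ of height $\ell$, $\ell\in[1,c]$. Then $$\sum_{\gamma\in\mathbb N^c}\mathrm P(\Gamma_1=\gamma_1,\dots,\Gamma_c=\gamma_c)\,x_1^{\gamma_1}\cdots x_c^{\gamma_c}=S_\rho(x_1,\dots,x_c;N)=\frac{s_{(a^b)}(1^b,x_1,\dots,x_c)}{s_{(a^b)}(1^{b+c})}.$$
   Context: Lozenge tilings of the hexagon with sides $(a,b,c,a,b,c)$ are in bijection with plane partitions $\pi$ (arrays of nonnegative integers weakly decreasing along rows and columns) with at most $b$ nonzero rows, at most $a$ nonzero columns and entries at most $c$, viewing $\pi$ as a pile of unit cubes whose visible surface is the tiling. A left corner is the visible corner of a cube (a top lozenge with the left and right lozenges directly below it), and its height is the $z$-coordinate of its top lozenge; under the bijection, $\Gamma_\ell$ equals the number of columns of $\pi$ containing the entry $\ell$. $s_\lambda$ is the Schur polynomial, $1^m$ denotes $m$ variables equal to $1$, and the normalized Schur polynomial is $S_\lambda(x_1,\dots,x_k;N)=s_\lambda(x_1,\dots,x_k,1^{N-k})/s_\lambda(1^N)$. *)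

(* Defs.v *)
From mathcomp Require Import all_boot all_order all_algebra.
From mathcomp Require Import mpoly.

Set Implicit Arguments.
Unset Strict Implicit.
Unset Printing Implicit Defensive.

Import GRing.Theory.

(* The box 0 <= x <= b, 0 <= y <= a, 0 <= z <= c is viewed from the direction
   (1,1,1), and the point (x, y, z) is drawn at the vertex (x + c - z, y + c - z)
   of the triangular lattice, whose edges have directions (1,0), (0,1), (1,1).
   Hence (1,0), (0,1) and (-1,-1) are the images of the unit vectors of the
   x-, y- and z-axis; in the picture they point down-left, down-right and up.
   The outline of the box, from (b,0,0) through (b,a,0), (0,a,0), (0,a,c),
   (0,0,c), (b,0,c), is the hexagon with sides (a,b,c,a,b,c). *)
Section LozengeTilings.
Variables a b c : nat.

Definition in_hexagon (p : nat * nat) : bool :=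
  [&& p.1 <= b + c, p.2 <= a + c, p.1 <= p.2 + b & p.2 <= p.1 + a]%N.

(* (s, u, v) is one of the two unit triangles (left one for s = true) into which
   the vertical edge from (u, v) to (u + 1, v + 1) cuts the unit parallelogram
   with top vertex (u, v). *)
Definition triangle : finType := (bool * 'I_(b + c) * 'I_(a + c))%type.

Definition triangle_at (s : bool) (u v : nat) (t : triangle) : bool :=
  [&& t.1.1 == s, t.1.2 == u :> nat & t.2 == v :> nat].

Definition vertices (t : triangle) : seq (nat * nat) :=
  let: (s, u, v) := t in
  [:: (u : nat, v : nat); (u.+1, v.+1); if s then (u.+1, v : nat) else (u : nat, v.+1)].

Definition hexagon : {set triangle} := [set t | all in_hexagon (vertices t)].

Definition share_edge (t1 t2 : triangle) : bool :=
  count (mem (vertices t2)) (vertices t1) == 2.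

Definition is_lozenge (L : {set triangle}) : bool :=
  [exists t1, exists t2, share_edge t1 t2 && (L == [set t1; t2])].

Definition tilings : {set {set {set triangle}}} :=
  [set T | partition T hexagon && [forall L in T, is_lozenge L]].

(* Sides along the x- and y-axis, highest vertex (u, v). *)
Definition top_lozenge (u v : nat) : {set triangle} :=
  [set t | triangle_at true u v t || triangle_at false u v t].

(* Sides along the y- and z-axis, highest vertex (u, v): the other vertices are
   (u, v + 1), (u + 1, v + 1) and (u + 1, v + 2). *)
Definition left_lozenge (u v : nat) : {set triangle} :=
  [set t | triangle_at false u v t || triangle_at true u v.+1 t].

(* The z-coordinate of the point of the stepped surface drawn at (u, v).  The
   vertical line downwards from (u, v) leaves the hexagon at a point of height 0.
   Along it, a unit edge either is an edge of the tiling, and z drops by 1, or is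
   the diagonal of a top lozenge, and z does not change. *)
Definition zcoord (T : {set {set triangle}}) (u v : nat) : nat :=
  (\sum_(k < b + c | in_hexagon (u + k.+1, v + k.+1))
     (top_lozenge (u + k) (v + k) \notin T))%N.

(* The left lozenge is the one across the lower-left side, from (u + 1, v) to
   (u + 1, v + 1), of the top lozenge. *)
Definition is_left_corner (T : {set {set triangle}}) (u v : nat) : bool :=
  (top_lozenge u v \in T) && (left_lozenge u.+1 v \in T).

Definition Gamma (l : nat) (T : {set {set triangle}}) : nat :=
  #|[set p : 'I_(b + c) * 'I_(a + c) |
      is_left_corner T p.1 p.2 && (zcoord T p.1 p.2 == l)]|.

End LozengeTilings.

Local Open Scope ring_scope.

Definition uniform_prob (X : finType) (Omega : {set X}) (E : pred X) : rat :=
  #|[set w in Omega | E w]|%:R / #|Omega|%:R.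

Section Schur.

Definition cell (lam : seq nat) : finType :=
  {i : 'I_(size lam) & 'I_(nth 0%N lam i)}.

Definition cell_row lam (p : cell lam) : nat := tag p.
Definition cell_col lam (p : cell lam) : nat := tagged p.

Definition is_ssyt (lam : seq nat) (n : nat) (t : {ffun cell lam -> 'I_n}) : bool :=
  [forall p, forall q,
    ((cell_row p == cell_row q) && (cell_col p <= cell_col q)%N ==> (t p <= t q)%N)
    && ((cell_col p == cell_col q) && (cell_row p < cell_row q)%N ==> (t p < t q)%N)].

(* s_lam(x_1, ..., x_n) with the variables given as the sequence x. *)
Definition schur (R : comNzRingType) (lam : seq nat) (x : seq R) : R :=
  \sum_(t : {ffun cell lam -> 'I_(size x)} | is_ssyt t) \prod_p x`_(t p).

Definition normalized_schur (R : comAlgType rat) (lam : seq nat) (x : seq R)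
    (N : nat) : R :=
  (schur lam (nseq N (1 : rat)))^-1 *: schur lam (x ++ nseq (N - size x) 1).

End Schur.

(* Main.v *)
(* Let p be a b x c array with entries in [0, a], weakly increasing along rows and
   columns.  The lengths of the rows of unit cubes parallel to the y-axis form such
   an array, up to a reversal of both indices, and the left corners of height l are
   counted by the sum over i of p(i,m) - max(p(i-1,m), p(i,m-1)), m = c + 1 - l: these
   numbers are the weights of the last-passage model whose passage times are p.
   Toggling diagonals, p' = max(up, left) + min(down, right) - p, transforms this
   statistic (this is RSK) into the difference of the sums over the diagonals
   ending in (b,m) and (b,m-1).  Read as a Gelfand-Tsetlin pattern, the array is a
   semistandard tableau of shape (a^b) with entries in [1, b + c], in which m occurs
   as often as that difference says, and the entries larger than c have weight 1.
   The resulting order of the variables is irrelevant since toggling a whole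
   diagonal exchanges two consecutive variables. *)

Require Import Defs.
From mathcomp Require Import classical_sets fsbigop mpoly.
From mathcomp Require Import all_boot all_order all_algebra perm zify.

Set Implicit Arguments.
Unset Strict Implicit.
Unset Printing Implicit Defensive.

Import GRing.Theory.

(** * Monotone arrays and toggles *)

Section Arrays.
Variables a b c : nat.
Local Notation array := {ffun 'I_b * 'I_c -> 'I_a.+1}.
Implicit Type P : array.

(* Cells are numbered from 1; the array is surrounded by the values 0 above and
   to the left, [a] below and to the right. *)
Definition pad P (i j : nat) : nat :=
  if (i == 0) || (j == 0) then 0
  else if insub i.-1 is Some x then
         if insub j.-1 is Some y then P (x, y) : nat else a
       else a.

Definition mk_array (f : nat -> nat -> nat) : array :=
  [ffun q : 'I_b * 'I_c => inord (f q.1.+1 q.2.+1)].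

Lemma pad0l P j : pad P 0 j = 0. Proof. by []. Qed.
Lemma pad0r P i : pad P i 0 = 0. Proof. by rewrite /pad orbT. Qed.

Lemma pad_out P i j : 0 < i -> 0 < j -> (b < i) || (c < j) -> pad P i j = a.
Proof.
case: i j => [|i] [|j] //= _ _; rewrite /pad /= => /orP[lt|lt].
  by rewrite insubN // -leqNgt.
by case: insub => // x; rewrite insubN // -leqNgt.
Qed.

Lemma padE P (x : 'I_b) (y : 'I_c) : pad P x.+1 y.+1 = P (x, y).
Proof. by rewrite /pad /= !valK. Qed.

Lemma pad_max P i j : pad P i j <= a.
Proof.
rewrite /pad; case: ifP => // _; case: insub => // x; case: insub => // y.
by rewrite -ltnS.
Qed.

Lemma pad_mk_array f i j : 0 < i <= b -> 0 < j <= c -> f i j <= a ->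
  pad (mk_array f) i j = f i j.
Proof.
case: i j => [|i] [|j] //= ib jc fa.
by rewrite (padE _ (Ordinal ib) (Ordinal jc)) ffunE /= inordK.
Qed.

Lemma eq_pad P Q :
  (forall i j, 0 < i <= b -> 0 < j <= c -> pad P i j = pad Q i j) -> P = Q.
Proof.
move=> PQ; apply/ffunP => -[x y]; apply/val_inj => /=.
by rewrite -!padE; apply: PQ; rewrite ltn_ord.
Qed.

Definition mono P : bool :=
  [forall x : 'I_b, forall y : 'I_c,
     (pad P x y.+1 <= pad P x.+1 y.+1) && (pad P x.+1 y <= pad P x.+1 y.+1)].

Lemma monoP P :
  reflect (forall i j, 0 < i <= b -> 0 < j <= c ->
             pad P i.-1 j <= pad P i j /\ pad P i j.-1 <= pad P i j)
          (mono P).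
Proof.
apply: (iffP forallP) => [mP [|i] [|j] //= ib jc|mP x].
  by have /forallP/(_ (Ordinal jc))/andP := mP (Ordinal ib).
apply/forallP => y.
by have [] := mP x.+1 y.+1; rewrite ?ltn_ord //= => -> ->.
Qed.

(** The border values 0 and [a] continue the monotonicity, so the cellwise condition extends to all
    indices. *)
Lemma pad_homo P i i' j j' : mono P -> i <= i' -> j <= j' ->
  pad P i j <= pad P i' j'.
Proof.
move=> /monoP mP ii jj; have hi i1 j1 : pad P i1 j1 <= pad P i1.+1 j1.
  case: i1 j1 => [|i1] [|j1]; rewrite ?pad0l ?pad0r //.
  have [lt|le] := ltnP i1.+1 b; last by rewrite (@pad_out _ i1.+2) ?pad_max ?ltnS ?le.
  have [ltj|lej] := ltnP j1 c; last by rewrite (@pad_out _ i1.+2) ?pad_max ?ltnS ?lej ?orbT.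
  by case: (mP i1.+2 j1.+1).
have hj i1 j1 : pad P i1 j1 <= pad P i1 j1.+1.
  case: i1 j1 => [|i1] [|j1]; rewrite ?pad0l ?pad0r //.
  have [lt|le] := ltnP i1 b; last by rewrite (@pad_out _ i1.+1 j1.+2) ?pad_max ?ltnS ?le.
  have [ltj|lej] := ltnP j1.+1 c;
    last by rewrite (@pad_out _ i1.+1 j1.+2) ?pad_max ?ltnS ?lej ?orbT.
  by case: (mP i1.+1 j1.+2).
apply: (@leq_trans (pad P i' j)).
  exact: (@homo_leq _ (fun i => pad P i j) leq leqnn (fun y x z => @leq_trans y x z)).
exact: (@homo_leq _ (fun j => pad P i' j) leq leqnn (fun y x z => @leq_trans y x z)).
Qed.

(* The part of a diagonal of the array that ends in cell [(i, k)]. *)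
Definition diag i k i' j' : bool := (i' <= i) && (i' + k == j' + i).

(** Each cell of the diagonal is reflected in the interval of values that its four neighbours allow.
    No two of these cells are adjacent, so the reflections do not interfere. *)
Definition toggle i k P : array :=
  mk_array (fun i' j' => if diag i k i' j' then
        maxn (pad P i'.-1 j') (pad P i' j'.-1)
          + minn (pad P i'.+1 j') (pad P i' j'.+1) - pad P i' j'
      else pad P i' j').

(** The reflected value is at most [a], so [inord] in [mk_array] does not alter it. *)
Lemma pad_toggle i k P i' j' : mono P -> 0 < i' <= b -> 0 < j' <= c ->
  pad (toggle i k P) i' j' =
    if diag i k i' j' then
        maxn (pad P i'.-1 j') (pad P i' j'.-1)
          + minn (pad P i'.+1 j') (pad P i' j'.+1) - pad P i' j'
      else pad P i' j'.
Proof.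
move=> mP ib jc; rewrite pad_mk_array //.
have := @pad_max P i' j'; have := @pad_max P i' j'.+1.
have := @pad_homo P i'.-1 i' j' j' mP (leq_pred _) (leqnn _).
have := @pad_homo P i' i' j'.-1 j' mP (leqnn _) (leq_pred _).
by case: ifP => _; lia.
Qed.

Lemma pad_toggle_id i k P i' j' : mono P -> ~~ diag i k i' j' ->
  pad (toggle i k P) i' j' = pad P i' j'.
Proof.
move=> mP dF.
have [ib|ib] := boolP (0 < i' <= b); last first.
  case: i' {dF} ib => [|i'] ib; first by rewrite !pad0l.
  case: j' => [|j']; first by rewrite !pad0r.
  by rewrite !pad_out //; apply/orP; left; lia.
have [jc|jc] := boolP (0 < j' <= c); last first.
  case: j' {dF} jc => [|j'] jc; first by rewrite !pad0r.
  by rewrite !pad_out //; [lia| apply/orP; right; lia |lia| apply/orP; right; lia].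
by rewrite pad_toggle // (negPf dF).
Qed.

Lemma mono_toggle i k P : mono P -> mono (toggle i k P).
Proof.
move=> mP; apply/monoP => i' j' ib jc.
have hi i1 j1 : pad P i1.-1 j1 <= pad P i1 j1 by exact: pad_homo (leq_pred _) (leqnn _).
have hj i1 j1 : pad P i1 j1.-1 <= pad P i1 j1 by exact: pad_homo (leqnn _) (leq_pred _).
have [dT|dF] := boolP (diag i k i' j').
  rewrite [pad _ i'.-1 _]pad_toggle_id //; last by move: dT; rewrite /diag; lia.
  rewrite [pad _ i' j'.-1]pad_toggle_id //; last by move: dT; rewrite /diag; lia.
  rewrite pad_toggle // dT.
  have := hi i'.+1 j'; have := hj i' j'.+1; have := hi i' j'; have := hj i' j'; rewrite /=; lia.
rewrite [pad _ i' j']pad_toggle_id //.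
(* [(i1, j1)] is the upper or the left neighbour. If it is toggled, its new value is at most the
   smaller of its lower and right neighbours, and [(i', j')] is one of these. *)
suff H : forall i1 j1, (i1 + j1).+1 = i' + j' -> i1 <= i' -> j1 <= j' ->
    pad (toggle i k P) i1 j1 <= pad P i' j' by split; apply: H; lia.
move=> i1 j1 e le1 le2.
have [d1|d1] := boolP (diag i k i1 j1); last by rewrite pad_toggle_id // pad_homo.
have [p1|p1] := boolP ((0 < i1) && (0 < j1)); last first.
  have [->|->] : i1 = 0 \/ j1 = 0 by lia.
    by rewrite pad0l.
  by rewrite pad0r.
rewrite pad_toggle ?d1; try lia.
have := hi i1 j1; have := hj i1 j1.
have : minn (pad P i1.+1 j1) (pad P i1 j1.+1) <= pad P i' j'.
  have [[-> ->]|[-> ->]] : (i' = i1.+1 /\ j' = j1) \/ (i' = i1 /\ j' = j1.+1) by lia.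
    exact: geq_minl.
  exact: geq_minr.
lia.
Qed.

Lemma toggleK i k P : mono P -> toggle i k (toggle i k P) = P.
Proof.
move=> mP; apply: eq_pad => i' j' ib jc.
have mP' := mono_toggle i k mP.
rewrite pad_toggle //; case: ifP => [dT|/negbT dF]; last by rewrite pad_toggle_id.
rewrite !(pad_toggle_id mP (i' := i'.-1)) ?(pad_toggle_id mP (i' := i'.+1)) //;
  try by move: dT; rewrite /diag; lia.
rewrite !(pad_toggle_id mP (j' := j'.-1)) ?(pad_toggle_id mP (j' := j'.+1)) //;
  try by move: dT; rewrite /diag; lia.
rewrite pad_toggle // dT.
have := @pad_homo P i'.-1 i' j' j' mP (leq_pred _) (leqnn _).
have := @pad_homo P i' i' j'.-1 j' mP (leqnn _) (leq_pred _).
have := @pad_homo P i' i'.+1 j' j' mP (leqnSn _) (leqnn _).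
have := @pad_homo P i' i' j' j'.+1 mP (leqnn _) (leqnSn _).
lia.
Qed.

Lemma big_toggle (R : Type) (idx : R) (op : Monoid.com_law idx) i k (F : array -> R) :
  \big[op/idx]_(P | mono P) F P = \big[op/idx]_(P | mono P) F (toggle i k P).
Proof.
rewrite (reindex_onto (toggle i k) (toggle i k)) => [|P]; last exact: toggleK.
apply: eq_bigl => P; apply/andP/idP => [[mP /eqP <-]|mP].
  exact: mono_toggle.
by rewrite mono_toggle // toggleK.
Qed.

(** Where the diagonal leaves the array on the left, truncated subtraction leads to column 0 and
    value 0; beyond column [c] the value is [a]. *)
Definition diag_sum i k P : nat := \sum_(r < i) pad P (i - r) (k - r).

Lemma diag_sum_toggle_id i k P i' k' : mono P -> i' + k != k' + i ->
  diag_sum i' k' (toggle i k P) = diag_sum i' k' P.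
Proof.
move=> mP ne; apply: eq_bigr => r _.
have [le|lt] := leqP k' r; first by rewrite (_ : k' - r = 0) ?pad0r //; lia.
by apply: pad_toggle_id => //; rewrite /diag; move: (ltn_ord r); lia.
Qed.

(* The diagonals next to the toggled one, [al] and [be], bound its cells by
   [max (al r.+1) (be r)] and [min (al r) (be r.-1)]; in the sum of these bounds
   each max meets the min of the same two cells. *)
Lemma diag_sum_toggle i k P : mono P -> i <= b -> k < c + i ->
  diag_sum i k (toggle i k P) + diag_sum i k P + pad P i k.+1
  = diag_sum i k.+1 P + diag_sum i k.-1 P + minn (pad P i k.+1) (pad P i.+1 k).
Proof.
move=> mP ib ki; rewrite /diag_sum -big_split /=.
pose al r := pad P (i - r) (k.+1 - r); pose be r := pad P (i - r) (k.-1 - r).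
pose be' r := pad P (i.+1 - r) (k - r).
rewrite (eq_bigr (fun r : 'I_i => maxn (al r.+1) (be r) + minn (al r) (be' r))); last first.
  move=> [r ri] _ /=; rewrite /al /be /be'.
  rewrite subSS !(subSn (ltnW ri)).
  have [le|lt] := leqP k r.
    rewrite (_ : k - r = 0) ?pad0r; last by lia.
    by rewrite (_ : k.-1 - r = 0) ?pad0r; last by lia.
  rewrite (_ : k.-1 - r = (k - r).-1); last lia.
  rewrite (_ : i - r.+1 = (i - r).-1); last lia.
  rewrite (subSn (ltnW lt)).
  have [kc|kc] := leqP (k - r) c.
    rewrite pad_toggle //; try lia.
    rewrite ifT; last by rewrite /diag; lia.
    have := @pad_homo P (i-r).-1 (i-r) (k-r) (k-r) mP (leq_pred _) (leqnn _).
    have := @pad_homo P (i-r) (i-r) (k-r).-1 (k-r) mP (leqnn _) (leq_pred _).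
    have := @pad_homo P (i-r) (i-r).+1 (k-r) (k-r) mP (leqnSn _) (leqnn _).
    have := @pad_homo P (i-r) (i-r) (k-r) (k-r).+1 mP (leqnn _) (leqnSn _).
    lia.
  (* Beyond column [c] the old and new values and the minimum are [a]. By [k < c + i] the row above
     is not row 0, so the maximum is [a] too. *)
  have pa i1 j1 : 0 < i1 -> c < j1 -> pad P i1 j1 = a.
    by move=> ? lt1; apply: pad_out => //; [exact: leq_ltn_trans lt1 | rewrite lt1 orbT].
  rewrite !(pa _ (k - r)) ?(pa _ (k - r).+1); try lia.
  rewrite pad_out ?kc ?orbT //; try lia.
  have := @pad_max P (i - r) (k - r).-1; lia.
rewrite big_split /=.
have al0 : al i = 0 by rewrite /al subnn pad0l.
have beS r : be' r.+1 = be r by rewrite /be' /be subSS; congr pad; lia.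
have -> : pad P i k.+1 = al 0 by rewrite /al !subn0.
have -> : pad P i.+1 k = be' 0 by rewrite /be' !subn0.
rewrite -[\sum_(r < i) pad P (i - r) (k.+1 - r)]/(\sum_(r < i) al r).
rewrite -[\sum_(r < i) pad P (i - r) (k.-1 - r)]/(\sum_(r < i) be r).
clearbody al be be'; case: i {ib ki mP} al be be' al0 beS => [|i] al be be' al0 beS.
  by rewrite !big_ord0 al0 min0n.
rewrite [\sum_(r < i.+1) maxn _ _]big_ord_recr /= [\sum_(r < i.+1) minn _ _]big_ord_recl /=.
rewrite [\sum_(r < i.+1) al r]big_ord_recl /= [\sum_(r < i.+1) be r]big_ord_recr /=.
rewrite al0 max0n; under [X in _ + (_ + X)]eq_bigr do rewrite /bump add1n beS.
under [X in _ = _ + X + _ + _]eq_bigr do rewrite /bump add1n.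
have : \sum_(j < i) maxn (al j.+1) (be j) + \sum_(j < i) minn (al j.+1) (be j)
   = \sum_(j < i) al j.+1 + \sum_(j < i) be j.
  by rewrite -!big_split /=; apply: eq_bigr => r _; lia.
set s1 := \sum_(j < i) maxn _ _; set s2 := \sum_(j < i) minn _ _.
set s3 := \sum_(j < i) al _; set s4 := \sum_(j < i) be _ => e.
lia.
Qed.

End Arrays.

(** * RSK and Bender-Knuth moves *)

Section RSK.
Variables a b c : nat.
Local Notation array := {ffun 'I_b * 'I_c -> 'I_a.+1}.
Implicit Type P : array.

Definition diag_step i k P : nat := diag_sum i k.+1 P - diag_sum i k P.

Lemma diag_sum_homo i k P : mono P -> diag_sum i k P <= diag_sum i k.+1 P.
Proof. by move=> mP; apply: leq_sum => r _; apply: pad_homo; lia. Qed.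

Lemma diag_sum0 i P : diag_sum i 0 P = 0.
Proof. by apply: big1 => r _; rewrite sub0n pad0r. Qed.

Lemma diag_sumS i k P : diag_sum i.+1 k.+1 P = pad P i.+1 k.+1 + diag_sum i k P.
Proof. by rewrite /diag_sum big_ord_recl !subn0; congr addn; apply: eq_bigr. Qed.

Definition corner_wt i k P : nat :=
  pad P i k.+1 - maxn (pad P i.-1 k.+1) (pad P i k).

(* The exponent of variable [l] when the rows up to [i] and the first [k] cells
   of row [i.+1] have been inserted; it interpolates between the corner weights
   ([i = k = 0]) and the diagonal differences. *)
Definition stage i k P l : nat :=
  (if l < k then diag_step i.+1 l P else corner_wt i.+1 l P + diag_step i l P)
    + \sum_(i.+2 <= i' < b.+1) corner_wt i' l P.

(** Only the exponent of variable [k] changes its form. There [diag_sum_toggle] applies, and its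
    minimum turns into the maximum in [corner_wt], since both together give the sum of the two
    cells. *)
Lemma stage_toggle i k P l : mono P -> i < b -> k < c ->
  stage i k P l = stage i k.+1 (toggle i k P) l.
Proof.
move=> mP ib kc; rewrite /stage; congr addn; last first.
  rewrite big_nat_cond [RHS]big_nat_cond; apply: eq_bigr => i' /andP[/andP[i1 i2] _].
  by rewrite /corner_wt !pad_toggle_id //; rewrite /diag; lia.
rewrite /diag_step ltnS; case: (ltngtP l k) => [lk|lk|->].
- by rewrite !diag_sum_toggle_id //; lia.
- by rewrite /corner_wt !pad_toggle_id ?diag_sum_toggle_id //; rewrite ?/diag; lia.
have := diag_sum_toggle mP (ltnW ib) (ltn_addr i kc).
rewrite diag_sumS pad_toggle_id //; last by rewrite /diag; lia.
rewrite (@diag_sum_toggle_id _ _ _ i k P i.+1 k) //; last by lia.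
have := @pad_homo _ _ _ P i.+1 i.+1 k k.+1 mP (leqnn _) (leqnSn _).
have := @pad_homo _ _ _ P i i.+1 k.+1 k.+1 mP (leqnSn _) (leqnn _).
have := diag_sum_homo i k mP; have := diag_sum_homo i k.-1 mP.
have -> : diag_sum i.+1 k P = if k == 0 then 0 else pad P i.+1 k + diag_sum i k.-1 P.
  by case: (k) => [|k'] /=; [exact: diag_sum0 | rewrite diag_sumS].
rewrite /corner_wt /=; case: (k) => [|k'] /=; last lia.
rewrite !diag_sum0 !pad0r; lia.
Qed.

(* With [pad P] read as last-passage times, [corner_wt] recovers the weight matrix and
   the toggles perform the RSK correspondence. *)
Lemma RSK_sum (R : comNzRingType) (y : nat -> R) :
  (\sum_(P : array | mono P) \prod_(l < c) y l ^+ (\sum_(1 <= i < b.+1) corner_wt i l P)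
   = \sum_(P : array | mono P) \prod_(l < c) y l ^+ diag_step b l P)%R.
Proof.
(* [G i] is the exponent after [i] full rows: it is [stage i 0], and [G i.+1] is [stage i c]. *)
pose G i P l := diag_step i l P + \sum_(i.+1 <= i' < b.+1) corner_wt i' l P.
suff H i : i <= b ->
    (\sum_(P : array | mono P) \prod_(l < c) y l ^+ G 0 P l
     = \sum_(P : array | mono P) \prod_(l < c) y l ^+ G i P l)%R.
  have := H b (leqnn b); rewrite /G => e.
  transitivity (\sum_(P : array | mono P) \prod_(l < c) y l ^+ G 0 P l)%R.
    by apply: eq_bigr => P _; apply: eq_bigr => l _; rewrite /G /diag_step /diag_sum !big_ord0.
  rewrite e; apply: eq_bigr => P _; apply: eq_bigr => l _.
  by rewrite big_geq // addn0.
elim: i => // i IH ib; rewrite IH ?(ltnW ib) //.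
transitivity (\sum_(P : array | mono P) \prod_(l < c) y l ^+ stage i 0 P l)%R.
  apply: eq_bigr => P _; apply: eq_bigr => l _; congr (_ ^+ _)%R.
  by rewrite /G /stage big_ltn // ltn0; lia.
transitivity (\sum_(P : array | mono P) \prod_(l < c) y l ^+ stage i c P l)%R; last first.
  apply: eq_bigr => P _; apply: eq_bigr => l _; congr (_ ^+ _)%R.
  by rewrite /G /stage ltn_ord.
clear IH; have H k : k <= c -> (\sum_(P : array | mono P) \prod_(l < c) y l ^+ stage i 0 P l
   = \sum_(P : array | mono P) \prod_(l < c) y l ^+ stage i k P l)%R.
  elim: k => // k IH kc; rewrite IH ?(ltnW kc) // [RHS](big_toggle _ i k).
  by apply: eq_bigr => P mP; apply: eq_bigr => l _; rewrite stage_toggle.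
exact: H.
Qed.

(* Toggling a whole diagonal is the Bender-Knuth involution. *)
Lemma diag_step_toggle k l P : mono P -> k.+1 < b + c ->
  diag_step b (if l == k then k.+1 else if l == k.+1 then k else l) P
  = diag_step b l (toggle b k.+1 P).
Proof.
move=> mP kbc.
have := diag_sum_toggle (k := k.+1) mP (leqnn b); rewrite addnC => /(_ _)/=.
have := diag_sum_homo b k mP; have := diag_sum_homo b k.+1 mP.
have := @pad_max _ _ _ P b k.+2.
(* Row [b.+1] has value [a], so the minimum is [pad P b k.+2] and cancels: the old and new sums of
   the toggled diagonal add up to the sums of its two neighbours. *)
rewrite (@pad_out _ _ _ P b.+1) ?ltnSn // => h1 h2 h3 h4.
have {}h4 := h4 ltac:(lia).
rewrite /diag_step; case: eqP => [->|lk].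
  by rewrite (@diag_sum_toggle_id _ _ _ _ _ _ _ k) //; lia.
case: eqP => [->|lk1].
  by rewrite (@diag_sum_toggle_id _ _ _ _ _ _ _ k.+2) //; lia.
by rewrite !diag_sum_toggle_id //; lia.
Qed.

(** The diagonals ending in row [b] form a Gelfand-Tsetlin pattern whose top row is [b] times [a],
    trailing zeros omitted; [diag_step] is its weight. *)
Definition gt_sum (R : comNzRingType) (y : seq R) : R :=
  (\sum_(P : array | mono P) \prod_(k < b + c) y`_k ^+ diag_step b k P)%R.

(** The arrays are reindexed by a toggle and the factors by the transposition of the two
    variables. *)
Lemma gt_sum_swap (R : comNzRingType) (s1 s2 : seq R) x y :
  size s1 + size s2 + 2 = b + c ->
  gt_sum (s1 ++ x :: y :: s2) = gt_sum (s1 ++ y :: x :: s2).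
Proof.
move=> sz; pose k := size s1; have kbc : k.+1 < b + c by rewrite /k; lia.
pose k0 := Ordinal (ltnW kbc); pose k1 := Ordinal kbc.
rewrite /gt_sum [RHS](big_toggle _ b k.+1); apply: eq_bigr => P mP.
rewrite (reindex_inj (@perm_inj _ (tperm k0 k1))); apply: eq_bigr => l _.
rewrite -diag_step_toggle //; congr (_ ^+ _)%R.
  rewrite !nth_cat; case: tpermP => [->|->|] /=.
  - by rewrite ltnNge leqnSn /= subSnn ltnn subnn.
  - by rewrite ltnn subnn /= ltnNge leqnSn /= subSnn.
  move=> /eqP; rewrite -val_eqE /= => lk /eqP; rewrite -val_eqE /= => lk1.
  case: ltnP => // kl; have -> : l - size s1 = (l - size s1).-2.+2 by rewrite -/k; lia.
  by [].
congr (diag_step b _ P); rewrite permE /= -!val_eqE /=.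
by case: ifP => //; case: ifP.
Qed.

Lemma gt_sum_move (R : comNzRingType) (s1 s s2 : seq R) x :
  size s1 + size s + size s2 + 1 = b + c ->
  gt_sum (s1 ++ x :: s ++ s2) = gt_sum (s1 ++ s ++ x :: s2).
Proof.
elim: s s1 => [|y s IH] s1 //= sz.
rewrite gt_sum_swap; last by rewrite size_cat; lia.
by rewrite -[LHS]/(gt_sum (s1 ++ y :: (x :: s ++ s2))) -cat_rcons IH ?cat_rcons // size_rcons; lia.
Qed.

Lemma gt_sum_perm (R : comNzRingType) (s t : seq R) :
  size s = b + c -> perm_eq s t -> gt_sum s = gt_sum t.
Proof.
(* The prefix [s1] keeps the total length fixed during the induction on [s]. *)
suff H s1 : size s1 + size s = b + c -> perm_eq s t ->
  gt_sum (s1 ++ s) = gt_sum (s1 ++ t) by exact: (H [::]).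
elim: s t s1 => [|x s IH] t s1 sz st.
  by have /esym/eqP/nilP -> := perm_size st.
have xt : x \in t by rewrite -(perm_mem st) mem_head.
case/splitPr: xt st => t1 t2.
rewrite perm_sym -[_ :: t2]cat1s perm_catCA /= perm_cons perm_sym => st.
have szt := perm_size st; rewrite size_cat in szt.
rewrite -cat_rcons (IH (t1 ++ t2)) // ?size_rcons; last by rewrite addSnnS.
by rewrite cat_rcons gt_sum_move //; move: sz szt => /=; lia.
Qed.

End RSK.

(** * Counting initial segments *)

Lemma sum_lt n k : \sum_(i < n) (i < k) = minn n k.
Proof. by elim: n => [|n IH]; rewrite ?big_ord0 ?min0n // big_ord_recr /= IH; lia. Qed.

Lemma leq_nat_of_bool (P Q : bool) : (P -> Q) -> P <= Q.
Proof. by case: P => // ->. Qed.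

(** This is conjugation of partitions: the count of a downward closed [Q] is the place where [Q]
    stops to hold. All the inverse bijections below rest on it. *)
Lemma lt_count n (Q : nat -> bool) y :
  (forall i j, i <= j -> j < n -> Q j -> Q i) -> y < n ->
  (y < \sum_(i < n) Q i) = Q y.
Proof.
move=> mQ yn; apply/idP/idP => [|Qy].
  apply: contraTT => nQ; rewrite -leqNgt.
  apply: (@leq_trans (\sum_(i < n) (i < y))); last by rewrite sum_lt; lia.
  apply: leq_sum => i _; case: ltnP => [|yi]; first by case: (Q i).
  by case: (boolP (Q i)) => // /mQ Qi; rewrite Qi in nQ.
apply: (@leq_trans (\sum_(i < n) (i < y.+1))); first by rewrite sum_lt; lia.
apply: leq_sum => i _; case: ltnP => // iy; by rewrite (mQ i y).
Qed.

(** * Schur polynomials of rectangles *)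

Section SchurRect.
Variables a b c : nat.
Local Notation array := {ffun 'I_b * 'I_c -> 'I_a.+1}.
Local Notation rho := (nseq b a).
Local Notation tableau := {ffun cell rho -> 'I_(b + c)}.
Implicit Types (P : array) (t : tableau) (p q : cell rho).

Lemma cell_row_lt p : cell_row p < b.
Proof. by have := ltn_ord (tag p); rewrite [X in _ < X]size_nseq. Qed.

Lemma cell_col_lt p : cell_col p < a.
Proof.
have := cell_row_lt p; case: p => i j; rewrite /cell_row /cell_col /= => ib.
by have := ltn_ord j; rewrite [X in _ < X]nth_nseq ib.
Qed.

Lemma big_cell (S : Type) (idx : S) (op : Monoid.com_law idx) (F : nat -> nat -> S) :
  \big[op/idx]_(p : cell rho) F (cell_row p) (cell_col p)
  = \big[op/idx]_(i < b) \big[op/idx]_(j < a) F i j.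
Proof.
transitivity (\big[op/idx]_(i < size rho) \big[op/idx]_(j < nth 0 rho i) F i j).
  by rewrite sig_big_dep.
rewrite size_nseq; apply: eq_bigr => i _; by rewrite nth_nseq ltn_ord.
Qed.

Lemma cell_inj p q : cell_row p = cell_row q -> cell_col p = cell_col q -> p = q.
Proof.
case: p q => i j [i' j']; rewrite /cell_row /cell_col /= => /val_inj ii.
by case: i' / ii j' => j' /val_inj ->.
Qed.

Lemma cell_exists i j : i < b -> j < a -> exists p, cell_row p = i /\ cell_col p = j.
Proof.
move=> ib ja; have ib' : i < size rho by rewrite size_nseq.
have ja' : j < nth 0 rho (Ordinal ib') by rewrite nth_nseq /= ib.
by exists (Tagged (fun i : 'I_(size rho) => 'I_(nth 0 rho i)) (Ordinal ja')).
Qed.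

(** The sum has at most one term; it reads the tableau at natural coordinates without dependent
    types. *)
Definition entry t i j : nat :=
  \sum_(p | (cell_row p == i) && (cell_col p == j)) t p.

Lemma entryE t p : entry t (cell_row p) (cell_col p) = t p.
Proof.
rewrite /entry (big_pred1 p) // => q; apply/andP/eqP => [[/eqP r /eqP s]|->//].
exact: cell_inj.
Qed.

Lemma entry_row t i j j' : is_ssyt t -> i < b -> j <= j' -> j' < a ->
  entry t i j <= entry t i j'.
Proof.
move=> st ib jj ja; have [p [<- pj]] := cell_exists ib (leq_ltn_trans jj ja).
have [q [qi qj]] := cell_exists (cell_row_lt p) ja.
rewrite -pj -{2}qi -qj !entryE; move/forallP/(_ p)/forallP/(_ q)/andP: st => [+ _].
by rewrite qi pj qj eqxx jj.
Qed.

Lemma entry_col t i i' j : is_ssyt t -> i < i' -> i' < b -> j < a ->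
  entry t i j < entry t i' j.
Proof.
move=> st ii ib ja; have [p [pi <-]] := cell_exists (ltn_trans ii ib) ja.
have [q [qi qj]] := cell_exists ib (cell_col_lt p).
rewrite -pi -qi -{2}qj !entryE; move/forallP/(_ p)/forallP/(_ q)/andP: st => [_].
by rewrite qi pi qj eqxx ii.
Qed.

Lemma entry_ge t i j : is_ssyt t -> i < b -> j < a -> i <= entry t i j.
Proof.
move=> st; elim: i => // i IH ib ja.
exact: leq_ltn_trans (IH (ltnW ib) ja) (entry_col st (ltnSn i) ib ja).
Qed.

(** Below the cell there are [b - i.+1] further cells with strictly increasing entries less than
    [b + c]; the induction is on their number [d]. *)
Lemma entry_le t i j : is_ssyt t -> i < b -> j < a -> entry t i j <= i + c.
Proof.
move=> st ib ja; have [d e] : exists d, d + i.+1 = b by exists (b - i.+1); rewrite subnK.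
elim: d i e ib => [|d IH] i e ib.
  have [p [pi pj]] := cell_exists ib ja; rewrite -pi -pj entryE.
  by have := ltn_ord (t p); have := cell_row_lt p; lia.
have ib1 : i.+1 < b by lia.
by have := IH i.+1 ltac:(lia) ib1; have := entry_col st (ltnSn i) ib1 ja; lia.
Qed.

(** Row [i] of the tableau has entries from [i] to [i + c]. After subtraction of [i], column [j] of
    array row [b - i] counts those less than [j]. Reversing the rows makes the array increase
    downwards. *)
Definition array_of_tab t : array :=
  mk_array a b c (fun i j => \sum_(y < a) (entry t (b - i) y <= b - i + j.-1)).

Definition tab_entry P i j : nat := i + \sum_(m < c) (pad P (b - i) m.+1 <= j).

Lemma tab_entry_lt P p : tab_entry P (cell_row p) (cell_col p) < b + c.
Proof.
apply: (@leq_trans ((cell_row p).+1 + c)); last by rewrite leq_add2r cell_row_lt.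
rewrite addSn ltnS leq_add2l.
apply: (@leq_trans (\sum_(m < c) 1)); last by rewrite sum1_card card_ord.
by apply: leq_sum => m _; exact: leq_b1.
Qed.

Definition tab_of_array P : tableau := [ffun p => Ordinal (tab_entry_lt P p)].

Lemma ltn_tab_entry P i j k : mono P -> 0 < k <= c ->
  (tab_entry P i j < i + k) = (j < pad P (b - i) k).
Proof.
move=> mP; case: k => // k /= kc; rewrite ltn_add2l ltnS leqNgt [RHS]ltnNge.
rewrite (@lt_count c (fun m => pad P (b - i) m.+1 <= j)) //.
by move=> m m' mm _; apply: leq_trans; apply: pad_homo.
Qed.

(** The entries less than [k] in row [i] are counted by an entry of the Gelfand-Tsetlin pattern; for
    [k <= i] and [k > i + c] the border of [pad] gives the right values 0 and [a]. *)
Lemma sum_tab_entry P i k : mono P -> i < b ->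
  \sum_(j < a) (tab_entry P i j < k) = pad P (b - i) (k - i).
Proof.
move=> mP ib; have [ki|ik] := leqP k i.
  rewrite (_ : k - i = 0) ?pad0r; last lia.
  by rewrite big1 // => j _; rewrite /tab_entry; lia.
have [kc|kc] := leqP (k - i) c.
  rewrite (eq_bigr (fun j : 'I_a => (j < pad P (b - i) (k - i)) : nat)) => [|j _].
    by rewrite sum_lt; have := pad_max P (b - i) (k - i); lia.
  by rewrite -ltn_tab_entry ?subnKC ?subn_gt0 ?ik // ltnW.
rewrite pad_out ?kc ?orbT //; try lia.
rewrite (eq_bigr (fun=> 1)) ?sum1_card ?card_ord // => j _.
have : \sum_(m < c) (pad P (b - i) m.+1 <= j) <= \sum_(m < c) 1.
  by apply: leq_sum => m _; exact: leq_b1.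
by rewrite sum1_card card_ord /tab_entry; lia.
Qed.

Lemma entry_tab P i j : i < b -> j < a -> entry (tab_of_array P) i j = tab_entry P i j.
Proof.
by move=> ib ja; have [p [<- <-]] := cell_exists ib ja; rewrite entryE ffunE.
Qed.

Lemma ssyt_tab P : mono P -> is_ssyt (tab_of_array P).
Proof.
move=> mP; apply/forallP => p; apply/forallP => q; rewrite !ffunE /= /tab_entry.
apply/andP; split; apply/implyP => /andP[/eqP-> le].
  rewrite leq_add2l; apply: leq_sum => m _.
  by apply: leq_nat_of_bool => /leq_trans; apply.
have H : \sum_(m < c) (pad P (b - cell_row p) m.+1 <= cell_col q)
  <= \sum_(m < c) (pad P (b - cell_row q) m.+1 <= cell_col q).
  apply: leq_sum => m _; apply: leq_nat_of_bool; apply: leq_trans.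
  by apply: pad_homo => //; apply: leq_sub2l; apply: ltnW.
lia.
Qed.

Lemma tabK P : mono P -> array_of_tab (tab_of_array P) = P.
Proof.
move=> mP; apply: eq_pad => i j ib jc; have ib' : b - i < b by lia.
have E : \sum_(y < a) (entry (tab_of_array P) (b - i) y <= b - i + j.-1) = pad P i j.
  rewrite (eq_bigr (fun y : 'I_a => (tab_entry P (b - i) y < b - i + j) : nat)).
    rewrite sum_tab_entry // addKn subKn //; lia.
  by move=> y _; rewrite entry_tab // -ltnS -addnS prednK //; lia.
by rewrite pad_mk_array ?E ?pad_max.
Qed.

Lemma pad_array_of_tab t i m : i < b -> m < c ->
  pad (array_of_tab t) (b - i) m.+1 = \sum_(y < a) (entry t i y <= i + m).
Proof.
move=> ib mc; rewrite pad_mk_array ?subKn //; try lia.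
apply: (@leq_trans (\sum_(y < a) 1)); last by rewrite sum1_card card_ord.
by apply: leq_sum => y _; exact: leq_b1.
Qed.

Lemma array_of_tabK t : is_ssyt t -> tab_of_array (array_of_tab t) = t.
Proof.
move=> st; apply/ffunP => p; apply/val_inj; rewrite ffunE /= /tab_entry.
have ib := cell_row_lt p; have ja := cell_col_lt p.
rewrite (eq_bigr (fun m : 'I_c => (m < t p - cell_row p) : nat)); last first.
  move=> m _; rewrite pad_array_of_tab // leqNgt.
  rewrite (@lt_count a (fun y => entry t (cell_row p) y <= cell_row p + m)) //.
    by rewrite entryE; lia.
  by move=> y y' yy ya; apply: leq_trans; apply: entry_row.
have := entry_ge st ib ja; have := entry_le st ib ja; rewrite sum_lt entryE.
by move: (cell_row p) (nat_of_ord (t p)) => r n; lia.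
Qed.

Lemma mono_array_of_tab t : is_ssyt t -> mono (array_of_tab t).
Proof.
move=> st; apply/monoP => i j ib jc.
have pe i1 j1 : 0 < i1 <= b -> 0 < j1 <= c -> pad (array_of_tab t) i1 j1 =
    \sum_(y < a) (entry t (b - i1) y < b - i1 + j1).
  move=> ib1 jc1; rewrite -[in LHS](@subKn i1 b) -1?[in LHS](@prednK j1) ?pad_array_of_tab; try lia.
  by apply: eq_bigr => y _; rewrite -ltnS -addnS prednK //; lia.
split.
  case: i ib => // i ib; case: i ib => [|i] ib /=; first by rewrite pad0l.
  rewrite !pe //; try lia; apply: leq_sum => y _.
  by have := @entry_col t (b - i.+2) (b - i.+1) y st ltac:(lia) ltac:(lia) (ltn_ord y); lia.
case: j jc => // j jc; case: j jc => [|j] jc /=; first by rewrite pad0r.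
by rewrite !pe //; try lia; apply: leq_sum => y _; lia.
Qed.

(** By [sum_tab_entry], [diag_sum b l] counts the entries less than [l] in the whole tableau. *)
Lemma diag_step_tab P k : mono P -> diag_step b k P = #|[pred p | tab_of_array P p == k :> nat]|.
Proof.
move=> mP; have H l : diag_sum b l P = \sum_p (tab_of_array P p < l).
  under eq_bigr => p _ do rewrite ffunE /=.
  rewrite (@big_cell _ 0 addn (fun i j => (tab_entry P i j < l) : nat)).
  by apply: eq_bigr => i _; rewrite sum_tab_entry.
rewrite -sum1_card big_mkcond /= /diag_step !H.
have -> : \sum_p (tab_of_array P p < k.+1) = \sum_p (tab_of_array P p < k)
    + \sum_p (if tab_of_array P p == k :> nat then 1 else 0).
  by rewrite -big_split; apply: eq_bigr => p _ /=; rewrite ltnS; case: ltngtP.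
by rewrite addKn; apply: eq_bigr => p _; rewrite inE.
Qed.

Lemma schur_rect (R : comNzRingType) (y : seq R) : size y = b + c ->
  schur rho y = gt_sum a b c y.
Proof.
move=> sz; rewrite /schur sz /gt_sum (reindex_onto tab_of_array array_of_tab);
  last exact: array_of_tabK.
apply: eq_big => [P|P /andP[st /eqP e]].
  apply/andP/idP => [[st /eqP <-]|mP]; first exact: mono_array_of_tab.
  by rewrite ssyt_tab // tabK.
have mP : mono P by rewrite -e mono_array_of_tab.
(* The cells are grouped by their entry. *)
rewrite (partition_big (tab_of_array P) predT) //=; apply: eq_bigr => k _.
rewrite diag_step_tab // -prodr_const; apply: eq_big => [p|p /eqP->] //.
Qed.

End SchurRect.

(** * Tilings as matchings *)

Section Tilings.
Variables a b c : nat.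
Local Notation tri := (triangle a b c).
Local Notation in_hex u v := (in_hexagon a b c (u, v)).
Implicit Types (t : tri) (T : {set {set tri}}).

Lemma in_hexE u v : in_hex u v =
  [&& u <= b + c, v <= a + c, u <= v + b & v <= u + a].
Proof. by []. Qed.

(** Membership of the left and of the right triangle at [(u, v)] in the hexagon, stated for all
    natural numbers instead of bounded ordinals. *)
Definition hexL u v : bool := [&& in_hex u v, in_hex u.+1 v.+1 & in_hex u.+1 v].
Definition hexR u v : bool := [&& in_hex u v, in_hex u.+1 v.+1 & in_hex u v.+1].

Lemma triangle_at_hexagon s u v t : triangle_at s u v t ->
  (t \in hexagon a b c) = if s then hexL u v else hexR u v.
Proof.
case: t => [[s' u'] v'] /and3P[/= /eqP-> /eqP uu /eqP vv]; rewrite inE /= uu vv.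
by case: s => /=; rewrite andbT.
Qed.

Lemma triangle_at_inj s u v t t' :
  triangle_at s u v t -> triangle_at s u v t' -> t = t'.
Proof.
case: t t' => [[s1 u1] v1] [[s2 u2] v2].
move=> /and3P[/= /eqP-> /eqP e1 /eqP e2] /and3P[/= /eqP-> /eqP e3 /eqP e4].
by congr (_, _, _); apply: val_inj; rewrite /= ?e1 ?e2.
Qed.

Lemma triangle_at_self t : triangle_at t.1.1 t.1.2 t.2 t.
Proof. by rewrite /triangle_at !eqxx. Qed.

Lemma triangle_exists s u v : (if s then hexL u v else hexR u v) ->
  exists t, triangle_at s u v t.
Proof.
move=> H; have [ub va] : u < b + c /\ v < a + c.
  by case: s H; rewrite /hexL /hexR !in_hexE; lia.
by exists (s, Ordinal ub, Ordinal va); rewrite /triangle_at /= !eqxx.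
Qed.

(** The right triangles [(u', v')] across the z-, the y- and the x-edge of the left triangle
    [(u, v)], in this order. *)
Definition near (u v u' v' : nat) : bool :=
  [|| (u' == u) && (v' == v), (u' == u.+1) && (v' == v) | (u' == u) && (v == v'.+1)].

Lemma share_edge_near s s' u v u' v' t t' :
  triangle_at s u v t -> triangle_at s' u' v' t' ->
  share_edge t t' = ((s != s') && if s then near u v u' v' else near u' v' u v).
Proof.
case: t t' => [[s1 u1] v1] [[s2 u2] v2].
move=> /and3P[/= /eqP-> /eqP e1 /eqP e2] /and3P[/= /eqP-> /eqP e3 /eqP e4].
rewrite /share_edge /= e1 e2 e3 e4 /near {u1 v1 u2 v2 e1 e2 e3 e4}.
(* The coordinate comparisons become six independent booleans; [excl] keeps the information which of
   them exclude each other. *)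
have excl (m n : nat) : [&& ~~ ((m == n) && (m == n.+1)), ~~ ((m == n) && (m.+1 == n))
    & ~~ ((m == n.+1) && (m.+1 == n))] by lia.
have := excl u u'; have := excl v v'.
have [eu1 eu2 eu3] : [/\ (u' == u) = (u == u'), (u' == u.+1) = (u.+1 == u')
  & (u'.+1 == u) = (u == u'.+1)] by rewrite ![_ == u]eq_sym ![_ == u.+1]eq_sym.
have [ev1 ev2 ev3] : [/\ (v' == v) = (v == v'), (v' == v.+1) = (v.+1 == v')
  & (v'.+1 == v) = (v == v'.+1)] by rewrite ![_ == v]eq_sym ![_ == v.+1]eq_sym.
case: s; case: s' => /=; rewrite !inE !xpair_eqE !eqSS ?eu1 ?eu2 ?eu3 ?ev1 ?ev2 ?ev3.
all: move: (u == u') (u == u'.+1) (u.+1 == u') (v == v') (v == v'.+1) (v.+1 == v').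
all: by do 6!case.
Qed.

(** A lozenge is given by its left and its right triangle, so that a tiling becomes a perfect
    matching of the left with the right triangles. *)
Definition pair_at (u v u' v' : nat) : {set tri} :=
  [set t | triangle_at true u v t || triangle_at false u' v' t].

Lemma pair_at_set2 u v u' v' t t' :
  triangle_at true u v t -> triangle_at false u' v' t' ->
  pair_at u v u' v' = [set t; t'].
Proof.
move=> ht ht'; apply/setP => x; rewrite !inE.
apply/orP/orP => [[h|h]|[/eqP->|/eqP->]]; [left|right|left|right] => //; apply/eqP.
  exact: triangle_at_inj h ht.
exact: triangle_at_inj h ht'.
Qed.

Lemma left_lozengeE u v : left_lozenge a b c u v = pair_at u v.+1 u v.
Proof. by apply/setP => t; rewrite !inE orbC. Qed.

Section Matching.
Variable T : {set {set tri}}.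
Hypothesis tT : T \in tilings a b c.

Let coverT : cover T = hexagon a b c.
Proof. by move: tT; rewrite inE => /andP[/and3P[/eqP]]. Qed.

Let trivT : trivIset T.
Proof. by move: tT; rewrite inE => /andP[/and3P[]]. Qed.

Lemma tiling_pair L : L \in T -> exists u v u' v',
  [/\ L = pair_at u v u' v', hexL u v, hexR u' v' & near u v u' v'].
Proof.
move=> LT; have sub t : t \in L -> t \in hexagon a b c.
  by rewrite -coverT => tL; apply/bigcupP; exists L.
have : is_lozenge L by move: tT; rewrite inE => /andP[_ /forall_inP]; apply.
case/existsP=> t1 /existsP[t2 /andP[sh /eqP EL]].
have := sub t1; have := sub t2; rewrite EL set21 set22 => /(_ isT) h2 /(_ isT) h1.
have T1 := triangle_at_self t1; have T2 := triangle_at_self t2.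
move: sh; rewrite (share_edge_near T1 T2).
rewrite (triangle_at_hexagon T1) in h1; rewrite (triangle_at_hexagon T2) in h2.
case: t1.1.1 T1 h1 => T1 h1; case: t2.1.1 T2 h2 => T2 h2 //= n.
  by exists t1.1.2, t1.2, t2.1.2, t2.2; split=> //; rewrite (pair_at_set2 T1 T2).
by exists t2.1.2, t2.2, t1.1.2, t1.2; split=> //; rewrite (pair_at_set2 T2 T1) setUC.
Qed.

Lemma mem_pair_at_true u v u' v' u1 v1 t :
  triangle_at true u1 v1 t -> (t \in pair_at u v u' v') = (u1 == u) && (v1 == v).
Proof.
move=> ht; rewrite inE /triangle_at; move/and3P: ht => [/eqP-> /eqP-> /eqP->].
by rewrite /= orbF.
Qed.

Lemma mem_pair_at_false u v u' v' u1 v1 t :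
  triangle_at false u1 v1 t -> (t \in pair_at u v u' v') = (u1 == u') && (v1 == v').
Proof.
move=> ht; rewrite inE /triangle_at; move/and3P: ht => [/eqP-> /eqP-> /eqP->].
by [].
Qed.

Lemma pair_at_inj u v u' v' u1 v1 u1' v1' : hexL u v -> hexR u' v' ->
  pair_at u v u' v' = pair_at u1 v1 u1' v1' -> [/\ u = u1, v = v1, u' = u1' & v' = v1'].
Proof.
move=> /(@triangle_exists true)[t ht] /(@triangle_exists false)[t' ht'] E.
have := mem_pair_at_true u v u' v' ht; rewrite E (mem_pair_at_true _ _ _ _ ht) !eqxx.
have := mem_pair_at_false u v u' v' ht'; rewrite E (mem_pair_at_false _ _ _ _ ht') !eqxx.
by move=> /andP[/eqP<- /eqP<-] /andP[/eqP<- /eqP<-].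
Qed.

Lemma tiling_pair_hex u v u' v' : pair_at u v u' v' \in T ->
  [/\ hexL u v, hexR u' v' & near u v u' v'].
Proof.
move=> /tiling_pair[u1 [v1 [u1' [v1' [E hL hR n]]]]].
by have [<- <- <- <-] := pair_at_inj hL hR (esym E).
Qed.

Lemma tiling_exists_right u v : hexL u v -> exists u' v', pair_at u v u' v' \in T.
Proof.
move=> h; have [t ht] := triangle_exists (s := true) h.
have : t \in cover T by rewrite coverT (triangle_at_hexagon ht).
case/bigcupP=> L LT; have [u1 [v1 [u' [v' [E _ _ _]]]]] := tiling_pair LT.
rewrite E (mem_pair_at_true _ _ _ _ ht) => /andP[/eqP-> /eqP->].
by exists u', v'; rewrite -E.
Qed.

Lemma tiling_exists_left u' v' : hexR u' v' -> exists u v, pair_at u v u' v' \in T.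
Proof.
move=> h; have [t ht] := triangle_exists (s := false) h.
have : t \in cover T by rewrite coverT (triangle_at_hexagon ht).
case/bigcupP=> L LT; have [u1 [v1 [u1' [v1' [E _ _ _]]]]] := tiling_pair LT.
rewrite E (mem_pair_at_false _ _ _ _ ht) => /andP[/eqP-> /eqP->].
by exists u1, v1; rewrite -E.
Qed.

Let pair_eq A B t : A \in T -> B \in T -> t \in A -> t \in B -> A = B.
Proof. by move=> AT BT tA tB; rewrite -(def_pblock trivT AT tA) (def_pblock trivT BT tB). Qed.

Lemma tiling_right_uniq u v u1 v1 u2 v2 :
  pair_at u v u1 v1 \in T -> pair_at u v u2 v2 \in T -> u1 = u2 /\ v1 = v2.
Proof.
move=> T1 T2; have [hL hR _] := tiling_pair_hex T1.
have [t ht] := triangle_exists (s := true) hL.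
have E : pair_at u v u1 v1 = pair_at u v u2 v2.
  by apply: (pair_eq T1 T2 (t := t)); rewrite (mem_pair_at_true _ _ _ _ ht) !eqxx.
by have [_ _ -> ->] := pair_at_inj hL hR E.
Qed.

Lemma tiling_left_uniq u v u1 v1 u2 v2 :
  pair_at u1 v1 u v \in T -> pair_at u2 v2 u v \in T -> u1 = u2 /\ v1 = v2.
Proof.
move=> T1 T2; have [hL hR _] := tiling_pair_hex T1.
have [t ht] := triangle_exists (s := false) hR.
have E : pair_at u1 v1 u v = pair_at u2 v2 u v.
  by apply: (pair_eq T1 T2 (t := t)); rewrite (mem_pair_at_false _ _ _ _ ht) !eqxx.
by have [-> -> _ _] := pair_at_inj hL hR E.
Qed.

(* Whether the edge leaving [(u, v)] in direction (1,0), resp. (0,1), (1,1) is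
   the diagonal of a lozenge. *)
Definition xdiag u v : bool := (0 < v) && (pair_at u v u v.-1 \in T).
Definition ydiag u v : bool := (0 < u) && (pair_at u.-1 v u v \in T).
Definition zdiag u v : bool := pair_at u v u v \in T.

(** A left triangle has exactly one partner, and the edge towards it is the only one of its three
    edges that is a diagonal. *)
Lemma diag_left u v : hexL u v -> zdiag u v + xdiag u v + ydiag u.+1 v = 1.
Proof.
move=> h; have [u1 [v1 m1]] := tiling_exists_right h.
have U u2 v2 : (pair_at u v u2 v2 \in T) = (u2 == u1) && (v2 == v1).
  apply/idP/andP => [m2|[/eqP-> /eqP->]//].
  by have [-> ->] := tiling_right_uniq m1 m2.
have [_ _] := tiling_pair_hex m1.
by rewrite /zdiag /xdiag /ydiag !U /near /=; lia.
Qed.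

Lemma diag_right u v : hexR u v -> zdiag u v + ydiag u v + xdiag u v.+1 = 1.
Proof.
move=> h; have [u1 [v1 m1]] := tiling_exists_left h.
have U u2 v2 : (pair_at u2 v2 u v \in T) = (u2 == u1) && (v2 == v1).
  apply/idP/andP => [m2|[/eqP-> /eqP->]//].
  by have [-> ->] := tiling_left_uniq m1 m2.
have [_ _] := tiling_pair_hex m1.
by rewrite /zdiag /xdiag /ydiag !U /near /=; lia.
Qed.

Lemma zdiag_hex u v : zdiag u v -> hexL u v && hexR u v.
Proof. by move=> /tiling_pair_hex[-> ->]. Qed.

Lemma xdiag_hex u v : xdiag u v -> [&& 0 < v, hexL u v & hexR u v.-1].
Proof. by move=> /andP[-> /tiling_pair_hex[-> ->]]. Qed.

Lemma ydiag_hex u v : ydiag u v -> [&& 0 < u, hexL u.-1 v & hexR u v].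
Proof. by move=> /andP[-> /tiling_pair_hex[-> ->]]. Qed.

Lemma zcoordS u v : in_hex u v ->
  zcoord T u v = if in_hex u.+1 v.+1 then ~~ zdiag u v + zcoord T u.+1 v.+1 else 0.
Proof.
move=> h; rewrite /zcoord; case: ifP => h1.
  have [n nE] : exists n, b + c = n.+1 by exists (b + c).-1; move: h1; rewrite in_hexE; lia.
  pose F u v k := if in_hex (u + k.+1) (v + k.+1) then
    (top_lozenge a b c (u + k) (v + k) \notin T) : nat else 0.
  transitivity (\sum_(k < b + c) F u v k); first by rewrite big_mkcond.
  transitivity (~~ zdiag u v + \sum_(k < b + c) F u.+1 v.+1 k); last by rewrite [in RHS]big_mkcond.
  (* The sum from [(u.+1, v.+1)] has one summand more, but the vertex of that summand lies outside
     the hexagon. *)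
  rewrite nE big_ord_recl [in RHS]big_ord_recr /= [X in _ = _ + (_ + X)]/F ifF; last first.
    by move: h; rewrite !in_hexE -nE; lia.
  rewrite addn0 {1}/F !addn1 h1 !addn0; congr addn.
  by apply: eq_bigr => k _; rewrite /F /bump /= !addSn !addnS.
by apply: big1 => k; rewrite in_hexE => h2; exfalso; move: h h1 h2; rewrite !in_hexE; lia.
Qed.

(** [zcoord] is defined along vertical lines; the other edges follow since the differences around a
    triangle are consistent by [diag_left] and [diag_right]. The induction runs downwards in the
    picture, with growing [u + v]. *)
Lemma zcoord_edges u v : in_hex u v ->
  (in_hex u.+1 v -> zcoord T u v = xdiag u v + zcoord T u.+1 v)
  /\ (in_hex u v.+1 -> zcoord T u v = ydiag u v + zcoord T u v.+1).
Proof.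
have [n] := ubnP (a + b + c + c - (u + v)); elim: n => // n IH in u v *.
rewrite ltnS => le h; rewrite (zcoordS h).
split=> h1; case: ifP => h2.
- have hL : hexL u v by rewrite /hexL h h1 h2.
  have := diag_left hL; have [|_ ->//] := IH u.+1 v _ h1; last lia.
  by move: h2 le; rewrite !in_hexE; lia.
(* The edge lies on the lower boundary, where both heights are 0. *)
- have /negPf-> : ~~ xdiag u v.
    by apply/negP => /xdiag_hex; rewrite /hexL h2; lia.
  rewrite (zcoordS h1) ifF //; move: h h1 h2; rewrite !in_hexE; lia.
- have hR : hexR u v by rewrite /hexR h h1 h2.
  have := diag_right hR; have [|->//] := IH u v.+1 _ h1; last lia.
  by move: h2 le; rewrite !in_hexE; lia.
have /negPf-> : ~~ ydiag u v.
  by apply/negP => /ydiag_hex; rewrite /hexR h2; lia.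
rewrite (zcoordS h1) ifF //; move: h h1 h2; rewrite !in_hexE; lia.
Qed.

End Matching.

End Tilings.

(** * Height functions *)

Section Heights.
Variables a b c : nat.
Local Notation array := {ffun 'I_b * 'I_c -> 'I_a.+1}.
Local Notation tri := (triangle a b c).
Local Notation in_hex u v := (in_hexagon a b c (u, v)).
Implicit Types (P : array) (T : {set {set tri}}) (z : nat -> nat -> nat).

(** The point drawn at [(u, v)] is [(u + z - c, v + z - c, z)], and the bounds place it in the box.
    The other conditions describe a stepped surface: z does not increase along x- and y-edges and
    drops by at most 1 along vertical edges. *)
Definition is_height z : Prop := forall u v, in_hex u v ->
  [/\ [&& c <= u + z u v, c <= v + z u v, z u v <= c, u + z u v <= b + c & v + z u v <= a + c],
      in_hex u.+1 v -> z u.+1 v <= z u v,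
      in_hex u v.+1 -> z u v.+1 <= z u v &
      in_hex u.+1 v.+1 -> z u v <= (z u.+1 v.+1).+1].

Section ZcoordHeight.
Variable T : {set {set tri}}.
Hypothesis tT : T \in tilings a b c.
Local Notation z := (zcoord T).

Lemma zcoord_bound u v : in_hex u v -> (u + z u v <= b + c) && (v + z u v <= a + c).
Proof.
have [n] := ubnP (b + c - u); elim: n => // n IH in u v *; rewrite ltnS => le h.
rewrite (zcoordS tT h); case: ifP => h1; last by move: h; rewrite !in_hexE; lia.
have := IH u.+1 v.+1 _ h1; case: (~~ _) => /= H.
  by have := H ltac:(move: h1; rewrite !in_hexE; lia); lia.
by have := H ltac:(move: h1; rewrite !in_hexE; lia); lia.
Qed.

(** No edge of the vertical right side is a diagonal, so z drops by 1 along each of them. *)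
Lemma zcoord_right u : u <= c -> u + z u (u + a) = c.
Proof.
have [n] := ubnP (c - u); elim: n => // n IH in u *; rewrite ltnS => le uc.
have h : in_hex u (u + a) by rewrite in_hexE; lia.
rewrite (zcoordS tT h).
have /negPf-> : ~~ zdiag T u (u + a).
  by apply/negP => /(zdiag_hex tT); rewrite /hexR !in_hexE; lia.
case: ifP => [|] h1; last by move: h1; rewrite in_hexE; lia.
rewrite -addSn /=; have := IH u.+1; move: h1; rewrite in_hexE; lia.
Qed.

Lemma zcoord_left v : v <= c -> v + z (v + b) v = c.
Proof.
have [n] := ubnP (c - v); elim: n => // n IH in v *; rewrite ltnS => le vc.
have h : in_hex (v + b) v by rewrite in_hexE; lia.
rewrite (zcoordS tT h).
have /negPf-> : ~~ zdiag T (v + b) v.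
  by apply/negP => /(zdiag_hex tT); rewrite /hexL !in_hexE; lia.
case: ifP => [|] h1; last by move: h1; rewrite in_hexE; lia.
rewrite -addSn /=; have := IH v.+1; move: h1; rewrite in_hexE; lia.
Qed.

(** Along y-edges z does not increase until the right side is reached, where equality holds. *)
Lemma zcoord_geu u v : in_hex u v -> c <= u + z u v.
Proof.
have [n] := ubnP (u + a - v); elim: n => // n IH in v *; rewrite ltnS => le h.
have [cu|uc] := leqP c u; first by rewrite (leq_trans cu) ?leq_addr.
have [E|ne] := eqVneq v (u + a); first by rewrite E zcoord_right // ltnW.
have h1 : in_hex u v.+1 by move: h; rewrite !in_hexE; lia.
have [_ /(_ h1)] := zcoord_edges tT h.
by have := IH v.+1 ltac:(move: h1; rewrite !in_hexE; lia) h1; lia.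
Qed.

Lemma zcoord_gev u v : in_hex u v -> c <= v + z u v.
Proof.
have [n] := ubnP (v + b - u); elim: n => // n IH in u *; rewrite ltnS => le h.
have [cu|uc] := leqP c v; first by rewrite (leq_trans cu) ?leq_addr.
have [E|ne] := eqVneq u (v + b); first by rewrite E zcoord_left // ltnW.
have h1 : in_hex u.+1 v by move: h; rewrite !in_hexE; lia.
have [/(_ h1) + _] := zcoord_edges tT h.
by have := IH u.+1 ltac:(move: h1; rewrite !in_hexE; lia) h1; lia.
Qed.

Lemma zcoord_lec u v : in_hex u v -> z u v <= c.
Proof.
elim: v => [|v IH] h.
  (* On the upper left side no x-edge is a diagonal, so z keeps the value [c] that it has at the
     corner [(b, 0)]. *)
  have [n] := ubnP (b - u); elim: n => // n IH in u h *; rewrite ltnS => le.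
  have [E|ne] := eqVneq u b; first by
    rewrite E; have := zcoord_left (leq0n c); rewrite !add0n => ->.
  have h1 : in_hex u.+1 0 by move: h; rewrite !in_hexE; lia.
  have [/(_ h1) -> _] := zcoord_edges tT h.
  by have := IH _ h1; move: h1; rewrite in_hexE /xdiag; lia.
have [h1|h1] := boolP (in_hex u v).
  by have [_ /(_ h)] := zcoord_edges tT h1; have := IH h1; lia.
have -> : u = v.+1 + b by move: h h1; rewrite !in_hexE; lia.
have vc : v.+1 <= c by move: h h1; rewrite !in_hexE; lia.
by have := zcoord_left vc; lia.
Qed.

Lemma zcoord_height : is_height z.
Proof.
move=> u v h; have [hx hy] := zcoord_edges tT h.
split=> [||| h1].
- by rewrite zcoord_geu ?zcoord_gev ?zcoord_lec ?zcoord_bound.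
- by move/hx; lia.
- by move/hy; lia.
by rewrite (zcoordS tT h) h1; lia.
Qed.

Lemma zdiagE u v : in_hex u v -> in_hex u.+1 v.+1 -> zdiag T u v = (z u v == z u.+1 v.+1).
Proof. by move=> h h1; rewrite (zcoordS tT h) h1; case: zdiag; lia. Qed.

Lemma xdiagE u v : in_hex u v -> in_hex u.+1 v -> xdiag T u v = (z u v != z u.+1 v).
Proof. by move=> h h1; have [/(_ h1) -> _] := zcoord_edges tT h; case: xdiag; lia. Qed.

Lemma ydiagE u v : in_hex u v -> in_hex u v.+1 -> ydiag T u v = (z u v != z u v.+1).
Proof. by move=> h h1; have [_ /(_ h1) ->] := zcoord_edges tT h; case: ydiag; lia. Qed.

End ZcoordHeight.

(* The lozenge of the two given adjacent triangles replaces the edge they share. *)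
Definition crossed z u v u' v' : bool :=
  if u' == u.+1 then z u.+1 v != z u.+1 v.+1
  else if v == v'.+1 then z u v != z u.+1 v
  else z u v == z u.+1 v.+1.

Lemma crossedz z u v : crossed z u v u v = (z u v == z u.+1 v.+1).
Proof. by rewrite /crossed !(ltn_eqF (ltnSn _)). Qed.

Lemma crossedy z u v : crossed z u v u.+1 v = (z u.+1 v != z u.+1 v.+1).
Proof. by rewrite /crossed eqxx. Qed.

Lemma crossedx z u v : crossed z u v.+1 u v = (z u v.+1 != z u.+1 v.+1).
Proof. by rewrite /crossed (ltn_eqF (ltnSn _)) eqxx. Qed.

(** The heights alone decide which lozenges occur; this makes [zcoord] injective on tilings. *)
Lemma mem_tiling T u v u' v' : T \in tilings a b c ->
  (pair_at a b c u v u' v' \in T)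
  = [&& hexL a b c u v, hexR a b c u' v', near u v u' v' & crossed (zcoord T) u v u' v'].
Proof.
move=> tT; have [|] := boolP [&& hexL a b c u v, hexR a b c u' v' & near u v u' v']; last first.
  move=> nh; have /negPf-> : pair_at a b c u v u' v' \notin T.
    by apply: contra nh => /(tiling_pair_hex tT)[-> -> ->].
  by apply/esym/negbTE; apply: contra nh => /and4P[-> -> ->].
move=> /and3P[hL hR n]; rewrite hL hR n /=.
have [h1 h2 h3] := and3P hL; have [h4 h5 h6] := and3P hR.
case/or3P: n => /andP[/eqP eu /eqP ev]; subst.
- by rewrite crossedz -(zdiagE tT).
- by rewrite crossedy -(ydiagE tT).
by rewrite crossedx -(xdiagE tT).
Qed.

Lemma tiling_ext T T' : T \in tilings a b c -> T' \in tilings a b c ->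
  (forall u v, in_hex u v -> zcoord T u v = zcoord T' u v) -> T = T'.
Proof.
move=> tT tT' E; have H u v u' v' :
    (pair_at a b c u v u' v' \in T) = (pair_at a b c u v u' v' \in T').
  rewrite !mem_tiling //; case: (boolP (hexL _ _ _ _ _)) => //= /and3P[h1 h2 h3].
  by rewrite /crossed !E.
by apply/setP => L; apply/idP/idP => h;
  [have [u [v [u' [v' [e _ _ _]]]]] := tiling_pair tT h
  |have [u [v [u' [v' [e _ _ _]]]]] := tiling_pair tT' h];
  move: h; rewrite e H.
Qed.

Section TilingOfHeight.
Variable z : nat -> nat -> nat.
Hypothesis hz : is_height z.

Definition tiling_of : {set {set tri}} :=
  let pos := ('I_(b + c) * 'I_(a + c))%type in
  [set pair_at a b c p.1.1 p.1.2 p.2.1 p.2.2 | p : pos * pos in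
    [set p : pos * pos | [&& hexL a b c p.1.1 p.1.2, hexR a b c p.2.1 p.2.2,
       near p.1.1 p.1.2 p.2.1 p.2.2 & crossed z p.1.1 p.1.2 p.2.1 p.2.2]]].

Lemma tiling_ofP L : reflect (exists u v u' v', L = pair_at a b c u v u' v' /\
   [&& hexL a b c u v, hexR a b c u' v', near u v u' v' & crossed z u v u' v'])
  (L \in tiling_of).
Proof.
apply: (iffP imsetP) => [[[p q] + ->]|[u [v [u' [v' [-> H]]]]]].
  by rewrite inE => H; exists p.1, p.2, q.1, q.2.
have [hL hR _ _] := and4P H.
have [u1 v1] : u < b + c /\ v < a + c by move: hL; rewrite /hexL !in_hexE; lia.
have [u1' v1'] : u' < b + c /\ v' < a + c by move: hR; rewrite /hexR !in_hexE; lia.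
by exists ((Ordinal u1, Ordinal v1), (Ordinal u1', Ordinal v1')); rewrite ?inE.
Qed.

Lemma mem_tiling_of u v u' v' : (pair_at a b c u v u' v' \in tiling_of) =
  [&& hexL a b c u v, hexR a b c u' v', near u v u' v' & crossed z u v u' v'].
Proof.
apply/tiling_ofP/idP => [[u1 [v1 [u1' [v1' [/esym E H]]]]]|H]; last by exists u, v, u', v'.
by have [hL hR _ _] := and4P H; have [<- <- <- <-] := pair_at_inj hL hR E.
Qed.

(** The drop of z along the vertical edge is 0 or 1 and splits into the drops along the other two
    edges, so one edge of the triangle is crossed. The bounds in [is_height] keep the partner inside
    the hexagon. *)
Lemma right_exists u v : hexL a b c u v -> exists u' v',
  [&& hexR a b c u' v', near u v u' v' & crossed z u v u' v'].
Proof.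
move=> hL; have [h1 h2 h3] := and3P hL.
have [B1 X1 _ Z1] := hz h1; have [B2 _ _ _] := hz h2; have [B3 _ Y3 _] := hz h3.
move: (X1 h3) (Z1 h2) (Y3 h2) B1 B2 B3 => {X1 Z1 Y3}.
move: h1 h2 h3; rewrite !in_hexE => h1 h2 h3.
have [e|ne] := eqVneq (z u v) (z u.+1 v.+1).
  by exists u, v; rewrite crossedz e /hexR /near !in_hexE; lia.
have [e1|ne1] := eqVneq (z u v) (z u.+1 v).
  by exists u.+1, v; rewrite crossedy /hexR /near !in_hexE; lia.
(* For [v = 0] the bounds force both ends of the x-edge to height [c]. *)
case: v => [|v] in h1 h2 h3 ne ne1 hL *; first lia.
by exists u, v; rewrite crossedx ne1 /hexR /near !in_hexE; lia.
Qed.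

Lemma left_exists u' v' : hexR a b c u' v' -> exists u v,
  [&& hexL a b c u v, near u v u' v' & crossed z u v u' v'].
Proof.
move=> hR; have [h1 h2 h3] := and3P hR.
have [B1 _ Y1 Z1] := hz h1; have [B2 _ _ _] := hz h2; have [B3 X3 _ _] := hz h3.
move: (Y1 h3) (Z1 h2) (X3 h2) B1 B2 B3 => {Y1 Z1 X3}.
move: h1 h2 h3; rewrite !in_hexE => h1 h2 h3.
have [e|ne] := eqVneq (z u' v') (z u'.+1 v'.+1).
  by exists u', v'; rewrite crossedz e /hexL /near !in_hexE; lia.
have [e1|ne1] := eqVneq (z u' v') (z u' v'.+1).
  by exists u', v'.+1; rewrite crossedx /hexL /near !in_hexE; lia.
case: u' => [|u'] in h1 h2 h3 ne ne1 hR *; first lia.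
by exists u', v'; rewrite crossedy ne1 /hexL /near !in_hexE; lia.
Qed.

Lemma right_uniq u v u1 v1 u2 v2 :
  [&& hexL a b c u v, near u v u1 v1 & crossed z u v u1 v1] ->
  [&& hexL a b c u v, near u v u2 v2 & crossed z u v u2 v2] -> u1 = u2 /\ v1 = v2.
Proof.
move=> /and3P[hL]; have [h1 h2 h3] := and3P hL.
have [_ X1 _ Z1] := hz h1; have [_ _ Y3 _] := hz h3.
move: (X1 h3) (Z1 h2) (Y3 h2) => {X1 Z1 Y3 h1 h2 h3 hL} i1 i2 i3.
move=> /or3P n1 x1 /and3P[_ /or3P n2].
case: n1 n2 x1 => /andP[/eqP e1 /eqP e2] [] /andP[/eqP e3 /eqP e4]; subst;
  rewrite ?crossedz ?crossedy ?crossedx; lia.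
Qed.

Lemma left_uniq u v u1 v1 u2 v2 :
  [&& hexR a b c u v, near u1 v1 u v & crossed z u1 v1 u v] ->
  [&& hexR a b c u v, near u2 v2 u v & crossed z u2 v2 u v] -> u1 = u2 /\ v1 = v2.
Proof.
move=> /and3P[hR]; have [h1 h2 h3] := and3P hR.
have [_ _ Y1 Z1] := hz h1; have [_ X3 _ _] := hz h3.
move: (Y1 h3) (Z1 h2) (X3 h2) => {Y1 Z1 X3 h1 h2 h3 hR} i1 i2 i3.
move=> /or3P n1 x1 /and3P[_ /or3P n2].
case: n1 n2 x1 => /andP[/eqP e1 /eqP e2] [] /andP[/eqP e3 /eqP e4];
  rewrite ?e1 ?e2 ?e3 ?e4; subst; rewrite ?crossedz ?crossedy ?crossedx; lia.
Qed.

Lemma tiling_of_tiling : tiling_of \in tilings a b c.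
Proof.
rewrite inE; apply/andP; split; last first.
  apply/forall_inP => L /tiling_ofP[u [v [u' [v' [-> /and4P[hL hR n _]]]]]].
  have [t ht] := triangle_exists (s := true) hL.
  have [t' ht'] := triangle_exists (s := false) hR.
  apply/existsP; exists t; apply/existsP; exists t'.
  by rewrite (share_edge_near ht ht') n (pair_at_set2 ht ht') eqxx.
apply/and3P; split.
- apply/eqP/setP => t; have ht := triangle_at_self t.
  apply/bigcupP/idP => [[L /tiling_ofP[u [v [u' [v' [-> /and4P[hL hR n _]]]]]]]|].
    rewrite inE => /orP[] h; by rewrite (triangle_at_hexagon h).
  rewrite (triangle_at_hexagon ht); move: ht; case: t.1.1 => ht.
    move=> hL; have [u' [v' /and3P[h1 h2 h3]]] := right_exists hL.
    exists (pair_at a b c t.1.2 t.2 u' v'); first by rewrite mem_tiling_of hL h1 h2.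
    by rewrite (mem_pair_at_true _ _ _ _ ht) !eqxx.
  move=> hR; have [u [v /and3P[h1 h2 h3]]] := left_exists hR.
  exists (pair_at a b c u v t.1.2 t.2); first by rewrite mem_tiling_of hR h1 h2.
  by rewrite (mem_pair_at_false _ _ _ _ ht) !eqxx.
- apply/trivIsetP => A B /tiling_ofP[u [v [u' [v' [-> /and4P[hL hR n x]]]]]].
  move=> /tiling_ofP[u1 [v1 [u1' [v1' [-> /and4P[hL1 hR1 n1 x1]]]]]].
  apply: contraR => /pred0Pn[t /andP[/=]]; rewrite inE => /orP[] ht.
    rewrite (mem_pair_at_true _ _ _ _ ht) => /andP[/eqP e1 /eqP e2].
    move: hL1 n1 x1; rewrite -e1 -e2 => hL1 n1 x1.
    have [||-> ->//] := @right_uniq u v u' v' u1' v1'; first by rewrite hL n x.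
    by rewrite hL n1 x1.
  rewrite (mem_pair_at_false _ _ _ _ ht) => /andP[/eqP e1 /eqP e2].
  move: hR1 n1 x1; rewrite -e1 -e2 => hR1 n1 x1.
  have [||-> ->//] := @left_uniq u' v' u v u1 v1; first by rewrite hR n x.
  by rewrite hR n1 x1.
apply/negP => /tiling_ofP[u [v [u' [v' [E /and4P[hL _ _ _]]]]]].
have [t ht] := triangle_exists (s := true) hL.
by have := mem_pair_at_true u v u' v' ht; rewrite -E inE !eqxx.
Qed.

(** Both functions vanish on the lower boundary and obey the same recursion along vertical lines. On
    the vertical sides, where one triangle is missing, the bounds force z to drop by 1. *)
Lemma zcoord_tiling_of u v : in_hex u v -> zcoord tiling_of u v = z u v.
Proof.
have [n] := ubnP (b + c - u); elim: n => // n IH in u v *; rewrite ltnS => le h.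
rewrite (zcoordS tiling_of_tiling h); case: ifP => h1; last first.
  by have [B _ _ _] := hz h; move: B h h1; rewrite !in_hexE; lia.
rewrite IH //; last by move: h1; rewrite in_hexE; lia.
have [B1 X1 Y1 /(_ h1) Z1] := hz h; have [B2 _ _ _] := hz h1.
rewrite /zdiag mem_tiling_of /near crossedz !eqxx /=.
have [hL|hL] := boolP (hexL a b c u v).
  have hy := and3P hL; have [_ _ h3] := hy; have [_ _ Y3 _] := hz h3.
  have [hR|hR] := boolP (hexR a b c u v).
    by have := X1 h3; have := Y3 h1; case: eqP; lia.
  by move: h h1 h3 hR B1 B2; rewrite /hexR !in_hexE; lia.
by move: h h1 hL B1 B2; rewrite /hexL !in_hexE; lia.
Qed.

End TilingOfHeight.

End Heights.

(** * Height functions and arrays *)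

Section HeightArray.
Variables a b c : nat.
Local Notation array := {ffun 'I_b * 'I_c -> 'I_a.+1}.
Local Notation tri := (triangle a b c).
Local Notation in_hex u v := (in_hexagon a b c (u, v)).
Implicit Types (P : array) (T : {set {set tri}}) (z : nat -> nat -> nat).

(* In a plane partition [pi] in the box, [pad P (b.+1 - X) m.+1] is the number of
   entries of row [X] that are at least [c - m]; the height at [(u, v)] is at least
   [c - m] iff the unit cube with outer corner [(u - m, v - m, c - m)] is present. *)
Definition height_of P u v : nat :=
  \sum_(m < c) (v - m <= pad P (b.+1 - (u - m)) m.+1).

(** The summand for [j] asks whether the unit cube with outer corner [(b.+1 - i, j.+1, c.+1 - m)] is
    present. *)
Definition array_of z : array :=
  mk_array a b c (fun i m => \sum_(j < a) (c < m + z (b - i + m) (j + m))).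

(** The conditions summed in [height_of] become weaker as [m] grows; in reversed order they hold on
    an initial segment, and [lt_count] applies. *)
Lemma leq_height_of P u v m : mono P -> m < c ->
  (c <= m + height_of P u v) = (v - m <= pad P (b.+1 - (u - m)) m.+1).
Proof.
move=> mP mc; pose K m := v - m <= pad P (b.+1 - (u - m)) m.+1.
have mK i j : i <= j -> K i -> K j.
  rewrite /K => ij h; apply: (leq_trans _ (leq_trans h _)); first exact: leq_sub2l.
  by apply: pad_homo => //; apply: leq_sub2l; apply: leq_sub2l.
have -> : height_of P u v = \sum_(i < c) K (c - i.+1).
  by rewrite /height_of -[LHS](big_mkord xpredT (fun m => K m : nat)) big_nat_rev big_mkord.
rewrite -[RHS]/(K m) (_ : m = c - (c - m.+1).+1); last lia.
rewrite -(@lt_count c (fun i => K (c - i.+1)) (c - m.+1)) //; try lia.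
by move=> i j ij jc; apply: mK; lia.
Qed.

Lemma is_height_height_of P : mono P -> is_height a b c (height_of P).
Proof.
move=> mP u v; rewrite in_hexE => h.
have zc u1 v1 : height_of P u1 v1 <= c.
  apply: (@leq_trans (\sum_(m < c) 1)); last by rewrite sum1_card card_ord.
  by apply: leq_sum => m _; exact: leq_b1.
(* Heights are compared through their thresholds [c - m]. *)
have le u1 v1 k : (forall m, m < c -> c <= m + height_of P u v -> c <= m + k + height_of P u1 v1) ->
    height_of P u v <= k + height_of P u1 v1.
  have [->//|z0 H] := posnP (height_of P u v).
  by have := H (c - height_of P u v); have := zc u v; lia.
split.
- rewrite zc /=; apply/and4P; split.
  + have [cu|uc] := leqP c u; first by rewrite (leq_trans cu) ?leq_addr.
    rewrite leq_height_of // subnn subn0 pad_out ?ltnSn //; lia.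
  + have [cu|uc] := leqP c v; first by rewrite (leq_trans cu) ?leq_addr.
    by rewrite leq_height_of // subnn.
  + have [ub|bu] := leqP u b; first by have := zc u v; lia.
    (* This [m] leads to row 0, where [pad] is 0 while [v - m] is positive. The choice [v - a.+1]
       below makes [v - m] equal to [a.+1], above every value of [pad]. *)
    have mc : u - b.+1 < c by lia.
    have := leq_height_of u v mP mc; rewrite (_ : b.+1 - _ = 0) ?pad0l; lia.
  have [ub|bu] := leqP v a; first by have := zc u v; lia.
  have mc : v - a.+1 < c by lia.
  have := leq_height_of u v mP mc.
  by have := pad_max P (b.+1 - (u - (v - a.+1))) (v - a.+1).+1; lia.
- move=> _; apply: leq_sum => m _; apply: leq_nat_of_bool => /leq_trans; apply.
  by apply: pad_homo => //; lia.
- by move=> _; apply: leq_sum => m _; apply: leq_nat_of_bool; apply: leq_trans; lia.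
move=> _; rewrite -add1n; apply: le => m mc; have [m1|] := leqP c (m + 1); first lia.
move=> m1; rewrite !leq_height_of //; try lia.
rewrite addn1 !subSS => /leq_trans; apply; exact: pad_homo.
Qed.

Section OfHeight.
Variable z : nat -> nat -> nat.
Hypothesis hz : is_height a b c z.

Lemma height_homo_v u v v' : v <= v' -> in_hex u v -> in_hex u v' -> z u v' <= z u v.
Proof.
elim: v' => [|v' IH]; first by rewrite leqn0 => /eqP->.
rewrite leq_eqVlt => /orP[/eqP-> //|vv h h'].
have h1 : in_hex u v' by move: h h' vv; rewrite !in_hexE; lia.
have [_ _ /(_ h') le _] := hz h1.
exact: leq_trans le (IH vv h h1).
Qed.

(** As z decreases in [v], the cubes counted by [array_of] form an initial segment. Row 0, that is
    [i = b], is included since there [u + z <= b + c] excludes every cube. *)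
Lemma pad_array_of i m j : i <= b -> m < c -> j < a ->
  (j < pad (array_of z) (b - i) m.+1) = (c <= m + z (i + m).+1 (j + m).+1).
Proof.
move=> ib mc ja; have [E|ne] := eqVneq i b.
  rewrite E subnn pad0l ltn0; apply/esym/negbTE; rewrite -ltnNge.
  have [|/and5P[_ _ _ +_] _ _ _] := hz (u := (b + m).+1) (v := (j + m).+1); last lia.
  by rewrite in_hexE; lia.
rewrite pad_mk_array; try lia; last first.
  apply: (@leq_trans (\sum_(m < a) 1)); last by rewrite sum1_card card_ord.
  by apply: leq_sum => k _; exact: leq_b1.
rewrite subKn // (@lt_count a (fun j => c < m.+1 + z (i + m.+1) (j + m.+1))) //.
  by rewrite !addnS addSn ltnS.
move=> j1 j2 j12 j2a; rewrite !addSn !ltnS => /leq_trans; apply; rewrite leq_add2l.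
by apply: height_homo_v; rewrite ?leq_add2r // in_hexE; lia.
Qed.

(** Rows grow downwards because z decreases in [u], and columns grow to the right because z drops by
    at most 1 along vertical edges. *)
Lemma mono_array_of : mono (array_of z).
Proof.
apply/monoP => i m ib mc.
have le i1 m1 i2 m2 : i2 <= b -> m1 < c -> m2 < c ->
   (forall j, j < a -> c <= m1 + z (i1 + m1).+1 (j + m1).+1 ->
                  c <= m2 + z (i2 + m2).+1 (j + m2).+1) -> i1 <= b ->
   pad (array_of z) (b - i1) m1.+1 <= pad (array_of z) (b - i2) m2.+1.
  move=> ib2 mc1 mc2 H ib1; rewrite leqNgt; apply/negP => lt.
  set j := pad _ _ _ in lt; have ja : j < a by apply: leq_trans lt (pad_max _ _ _).
  by have := H _ ja; rewrite -!pad_array_of // lt ltnn => /(_ isT).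
case: m mc => // m mc; split.
  rewrite (_ : i.-1 = b - (b - i).+1) 1?{2}(_ : i = b - (b - i)); try lia.
  apply: le; try lia; move=> j ja.
  have [|_ + _ _] := hz (u := (b - i + m).+1) (v := (j + m).+1); first by rewrite in_hexE; lia.
  by rewrite addSn => /(_ _); rewrite in_hexE; lia.
case: m mc => [|m] mc; first by rewrite pad0r.
rewrite (_ : i = b - (b - i)); try lia.
apply: le; try lia; move=> j ja.
have [|_ _ _] := hz (u := (b - i + m).+1) (v := (j + m).+1); first by rewrite in_hexE; lia.
by rewrite !addnS => /(_ _); rewrite in_hexE; lia.
Qed.

Lemma height_of_array_of u v : in_hex u v -> height_of (array_of z) u v = z u v.
Proof.
move=> h; have [/and5P[B1 B2 B3 B4 B5] _ _ _] := hz h; move: (h); rewrite in_hexE => h'.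
rewrite /height_of (eq_bigr (fun m : 'I_c => (c <= m + z u v) : nat)).
  rewrite -(big_mkord xpredT (fun m => (c <= m + z u v) : nat)) big_nat_rev /= big_mkord.
  rewrite (eq_bigr (fun m : 'I_c => (m < z u v) : nat)) => [|m _].
    by rewrite sum_lt; lia.
  by have := ltn_ord m; lia.
move=> [m mc] _ /=; congr nat_of_bool.
(* Outside the box the border of [pad] and the bounds on z decide both conditions alike; inside it
   [pad_array_of] applies. *)
have [vm|mv] := leqP v m; first by rewrite (_ : v - m = 0); lia.
have [um|mu] := leqP u m.
  by rewrite (_ : u - m = 0) ?pad_out ?ltnSn //; lia.
have [ub|bu] := leqP (u - m) b; last by rewrite (_ : b.+1 - _ = 0) ?pad0l; lia.
have [va|av] := leqP (v - m) a; last first.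
  by have := pad_max (array_of z) (b.+1 - (u - m)) m.+1; lia.
have -> : b.+1 - (u - m) = b - (u - m.+1) by lia.
have -> : v - m = (v - m.+1).+1 by lia.
rewrite pad_array_of //; try lia.
by rewrite -!addnS !subnK.
Qed.

End OfHeight.

Lemma array_of_height_of P : mono P -> array_of (height_of P) = P.
Proof.
move=> mP; have hz := is_height_height_of mP; apply: eq_pad => i [|m] //= ib mc.
have H j : j < a -> (j < pad (array_of (height_of P)) i m.+1) = (j < pad P i m.+1).
  move=> ja; rewrite [in LHS](_ : i = b - (b - i)); last lia.
  rewrite pad_array_of //; try lia.
  by rewrite leq_height_of // -!addSn !addnK subSS subKn //; lia.
apply/eqP; rewrite eqn_leq; apply/andP; split; rewrite leqNgt; apply/negP => lt.
  by have := H _ (leq_trans lt (pad_max _ _ _)); rewrite lt ltnn.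
by have := H _ (leq_trans lt (pad_max _ _ _)); rewrite lt ltnn.
Qed.

Lemma array_of_ext z z' : (forall u v, in_hex u v -> z u v = z' u v) ->
  array_of z = array_of z'.
Proof.
move=> E; apply/ffunP => -[i m]; rewrite !ffunE; congr inord.
apply: eq_bigr => j _; rewrite E // in_hexE /=.
by have := ltn_ord i; have := ltn_ord j; have := ltn_ord m; lia.
Qed.

Definition array_of_tiling T : array := array_of (zcoord T).
Definition tiling_of_array P : {set {set tri}} := tiling_of a b c (height_of P).

Lemma big_tilings (R : Type) (idx : R) (op : Monoid.com_law idx) (F : array -> R) :
  \big[op/idx]_(T in tilings a b c) F (array_of_tiling T)
  = \big[op/idx]_(P | mono P) F P.
Proof.
have K P : mono P -> array_of_tiling (tiling_of_array P) = P.
  move=> mP; rewrite -[RHS]array_of_height_of //; apply: array_of_ext => u v h.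
  exact: zcoord_tiling_of (is_height_height_of mP) _ _ h.
have K' T : T \in tilings a b c -> tiling_of_array (array_of_tiling T) = T.
  move=> tT; have hz := zcoord_height tT.
  have mz := mono_array_of hz.
  apply: tiling_ext => // [|u v h]; first exact: tiling_of_tiling (is_height_height_of mz).
  by rewrite zcoord_tiling_of ?height_of_array_of //; apply: is_height_height_of.
rewrite (reindex_onto tiling_of_array array_of_tiling) //.
apply: eq_big => [P|P /andP[_ /eqP->]] //.
apply/andP/idP => [[tT /eqP <-]|mP]; first exact: mono_array_of (zcoord_height tT).
by rewrite K // eqxx; split=> //; apply: tiling_of_tiling (is_height_height_of mP).
Qed.

Lemma big_shift (F : nat -> nat) n k s : k + s <= n ->
  (forall u, F u != 0 -> s <= u < s + k) ->
  \sum_(u < n) F u = \sum_(i < k) F (i + s).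
Proof.
move=> ksn F0; rewrite -(big_mkord xpredT F) (@big_cat_nat _ _ _ s) //=; last lia.
rewrite (@big_cat_nat _ _ _ (k + s) s) //=; last lia.
have F00 m1 m2 : (m2 <= s) || (s + k <= m1) -> \sum_(m1 <= u < m2) F u = 0.
  move=> H; rewrite big_nat_cond big1 // => u; have := F0 u.
  by case: eqVneq => // _ /(_ isT); lia.
rewrite F00 ?leqnn // (F00 (k + s)) ?(addnC k) ?leqnn ?orbT //.
by rewrite add0n addn0 -[X in \sum_(X <= _ < _) _]add0n big_addn addKn big_mkord.
Qed.

(** A point [(x, y, l)] of the surface is drawn at [(x + k, y + k)] with [k = c - l], so the corners
    of height [l] are sorted by [x < b]. For fixed [x] they are the [y] from the maximum in
    [corner_wt] up to the value of the cell. *)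
Lemma Gamma_array T l : T \in tilings a b c -> 0 < l <= c ->
  Gamma l T = \sum_(1 <= i < b.+1) corner_wt i (c - l) (array_of_tiling T).
Proof.
move=> tT lc; set k := c - l; have kl : k + l = c by rewrite subnK; lia.
have hz := zcoord_height tT.
pose C u v := is_left_corner T u v && (zcoord T u v == l).
have CE u v : C u v = [&& zdiag T u v, xdiag T u.+1 v.+1 & zcoord T u v == l].
  by rewrite /C /is_left_corner left_lozengeE -andbA.
transitivity (\sum_(u < b + c) \sum_(v < a + c) C u v).
  rewrite pair_big /= /Gamma -sum1_card big_mkcond /=.
  by apply: eq_bigr => -[u v] _; rewrite inE /C; case: (_ && _).
have Crange u v : C u v -> (k <= u < k + b) && (k <= v < k + a).
  rewrite CE => /and3P[zd _ /eqP zl]; have /andP[hL _] := zdiag_hex tT zd.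
  have [h1 h2 _] := and3P hL; move: zd; rewrite zdiagE // zl => /eqP zl'.
  have [/and5P[? ? _ _ _] _ _ _] := hz _ _ h1.
  have [/and5P[_ _ _ ? ?] _ _ _] := hz _ _ h2; lia.
rewrite (@big_shift (fun u => \sum_(v < a + c) C u v) _ b k) /=; first last.
- move=> u; apply: contraR => nu; rewrite big1 // => v _.
  by case: (boolP (C u v)) => // /Crange; rewrite (negPf nu).
- lia.
rewrite big_add1 /= big_nat_rev big_mkord; apply: eq_bigr => i _.
have ib := ltn_ord i.
rewrite (@big_shift (fun v => C (i + k) v) _ a k) /=; first last.
- by move=> v; case: (boolP (C _ v)) => // /Crange /andP[_ ->].
- lia.
rewrite add0n /corner_wt /= (_ : (b - i.+1).+1 = b - i); last lia.
set P := array_of_tiling T.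
rewrite (eq_bigr (fun j : 'I_a => (j < pad P (b - i) k.+1)
    - (j < maxn (pad P (b - i.+1) k.+1) (pad P (b - i) k)))).
  have mP : mono P by exact: mono_array_of.
  have H1 : pad P (b - i.+1) k.+1 <= pad P (b - i) k.+1 by apply: pad_homo => //; lia.
  have H2 : pad P (b - i) k <= pad P (b - i) k.+1 by apply: pad_homo.
  have H3 := pad_max P (b - i) k.+1.
  apply/eqP; rewrite -(eqn_add2r (\sum_(j < a)
    (j < maxn (pad P (b - i.+1) k.+1) (pad P (b - i) k)))).
  rewrite -big_split /=; apply/eqP.
  rewrite (eq_bigr (fun j : 'I_a => (j < pad P (b - i) k.+1) : nat)) => [|j _]; last first.
    by rewrite subnK //; apply: leq_nat_of_bool; lia.
  by rewrite !sum_lt; lia.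
move=> j _; have ja := ltn_ord j.
have -> : (j < maxn (pad P (b - i.+1) k.+1) (pad P (b - i) k))
  = (j < pad P (b - i.+1) k.+1) || (j < pad P (b - i) k) by lia.
rewrite !pad_array_of //; try lia.
(* With A, B, D the vertices in [hA], [hB], [hD], a left corner means that A and B have height [l]
   and D a smaller one. The three comparisons with [j] say that B has height at least [l], D at
   least [l], and A more than [l]. *)
have hA : in_hex (i + k) (j + k) by rewrite in_hexE; lia.
have hB : in_hex (i + k).+1 (j + k).+1 by rewrite in_hexE; lia.
have hD : in_hex (i + k).+2 (j + k).+1 by rewrite in_hexE; lia.
rewrite CE zdiagE // xdiagE //.
have [/and5P[_ _ ? _ _] _ _ ?] := hz _ _ hA.
have [_ ? _ _] := hz _ _ hB.
have zAB : zcoord T (i + k).+1 (j + k).+1 <= zcoord T (i + k) (j + k).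
  by rewrite [leqRHS](zcoordS tT hA) hB leq_addl.
have -> : (j < pad P (b - i) k) = (l < zcoord T (i + k) (j + k)).
  (* For [k = 0] the height [l] is [c], which A cannot exceed. *)
  have [k0|k0] := posnP k; first by rewrite [in LHS]k0 pad0r; lia.
  rewrite -[in LHS](prednK k0) pad_array_of //; try lia.
  by rewrite -!addnS prednK //; lia.
rewrite addSn; lia.
Qed.

End HeightArray.

(** * The generating function of the left corners *)

Local Open Scope ring_scope.

Section Main.
Variables a b c : nat.

Lemma schur_rect_perm (R : comNzRingType) (s t : seq R) :
  size s = (b + c)%N -> perm_eq s t -> schur (nseq b a) s = schur (nseq b a) t.
Proof.
move=> ss st; rewrite (schur_rect a ss) (gt_sum_perm a ss st).
by rewrite (@schur_rect a b c) // -(perm_size st).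
Qed.

(** Height [l] belongs to array index [c - l], so the variables appear in reversed order, which the
    symmetry of [gt_sum] undoes. The last [b] variables are 1 and do not contribute. *)
Lemma tilings_schur (R : comNzRingType) (x : seq R) : size x = c ->
  \sum_(T in tilings a b c) \prod_(i < c) x`_i ^+ Gamma i.+1 T
  = schur (nseq b a) (x ++ nseq b 1).
Proof.
move=> sx; have szr : size (rev x ++ nseq b 1) = (b + c)%N.
  by rewrite size_cat size_rev size_nseq sx addnC.
rewrite (@schur_rect a b c); last by rewrite size_cat size_nseq sx addnC.
rewrite -(gt_sum_perm a szr); last by rewrite perm_cat2r perm_rev.
pose w P := \prod_(l < c) (rev x)`_l ^+ (\sum_(1 <= i < b.+1) @corner_wt a b c i l P).
transitivity (\sum_(T in tilings a b c) w (array_of_tiling T)).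
  apply: eq_bigr => T tT; rewrite /w (reindex_inj rev_ord_inj).
  apply: eq_bigr => l _; rewrite (Gamma_array tT) /=; last by have := ltn_ord l; lia.
  have lc := ltn_ord l; rewrite nth_rev ?sx; last lia.
  by rewrite (_ : c - (c - l.+1).+1 = l)%N //; lia.
rewrite (big_tilings _ w) RSK_sum; apply: eq_bigr => P mP.
rewrite -(big_mkord xpredT (fun k => (rev x ++ nseq b 1)`_k ^+ diag_step b k P)).
rewrite addnC big_mkord big_split_ord /= [X in _ = _ * X]big1 ?mulr1 => [|r _]; last first.
  by rewrite nth_cat size_rev sx ltnNge leq_addr /= addKn nth_nseq ltn_ord expr1n.
by apply: eq_bigr => l _; rewrite nth_cat size_rev sx ltn_ord.
Qed.

(** The index type may be infinite, but the probability vanishes outside the finite list [r] of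
    attained values; exchanging the sums leaves one term per outcome. *)
Lemma fsbig_uniform_prob (R : comAlgType rat) (X : finType) (I : choiceType)
    (Omega : {set X}) (g : X -> I) (F : I -> R) :
  \sum_(i \in [set: I]%classic) uniform_prob Omega (fun w => g w == i) *: F i
  = (#|Omega|%:R)^-1 *: \sum_(w in Omega) F (g w).
Proof.
pose r := undup [seq g w | w <- enum Omega].
have rP w : w \in Omega -> g w \in r.
  by move=> wO; rewrite mem_undup map_f // mem_enum.
rewrite (fsbigE r) ?undup_uniq //; first last.
- by move=> i _ ir; rewrite /uniform_prob (_ : [set _ in _ | _] = finset.set0) ?cards0
      ?mul0r ?scale0r //;
    apply/setP => w; rewrite !inE; apply/negP => /andP[/rP + /eqP gi]; rewrite gi (negPf ir).
transitivity (\sum_(i <- r) uniform_prob Omega (fun w => g w == i) *: F i).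
  by apply: eq_bigl => i; rewrite classical_sets.in_setT.
rewrite (eq_bigr (fun i => (#|Omega|%:R)^-1 *: \sum_(w in Omega | g w == i) F i)).
  rewrite -scaler_sumr (exchange_big_dep (mem Omega)) /=; last by move=> i w _ /andP[].
  congr (_ *: _); apply: eq_bigr => w wO.
  rewrite (eq_bigl (fun i => i == g w)) => [|i]; last by rewrite wO eq_sym.
  by rewrite -big_filter filter_pred1_uniq ?undup_uniq ?rP // big_seq1.
move=> i _; rewrite /uniform_prob mulrC -scalerA; congr (_ *: _).
by rewrite sumr_const scaler_nat; congr (_ *+ _); apply: eq_card => w; rewrite !inE.
Qed.

End Main.

Theorem theorem5p1 (a b c : nat) (ha : (0 < a)%N) (hb : (0 < b)%N) (hc : (0 < c)%N) :
  let rho : seq nat := nseq b a in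
  let N : nat := (b + c)%N in
  let x : seq {mpoly rat[c]} := [seq 'X_i | i : 'I_c] in
  (\sum_(g \in [set: 'X_{1..c}]%classic)
      uniform_prob (tilings a b c) (fun T => [forall i : 'I_c, Gamma i.+1 T == g i])
        *: \prod_(i < c) 'X_i ^+ g i
   = normalized_schur rho x N)%R
  /\
  (normalized_schur rho x N
   = (schur rho (nseq N (1 : rat)))^-1 *: schur rho (nseq b 1 ++ x))%R.
Proof.
move=> rho N x; have sx : size x = c by rewrite size_image card_ord.
have sz : size (x ++ nseq (N - size x) 1) = (b + c)%N.
  by rewrite size_cat size_nseq sx /N; lia.
split; last first.
  congr (_ *: _); apply: (schur_rect_perm a sz).
  by rewrite sx /N addnK perm_catC.
(* At [x = 1] each tiling contributes 1, which identifies the normalizing constant. *)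
have card_tilings : schur rho (nseq N (1 : rat)) = #|tilings a b c|%:R.
  rewrite /N addnC nseqD -sumr_const.
  rewrite -(@tilings_schur a b c rat (nseq c 1) (size_nseq c 1)).
  by apply: eq_bigr => T _; apply: big1 => i _; rewrite nth_nseq ltn_ord expr1n.
rewrite /normalized_schur card_tilings sx /N addnK -(@tilings_schur a b c _ x sx).
pose g (T : {set {set triangle a b c}}) : 'X_{1..c} := [multinom Gamma i.+1 T | i < c].
transitivity (\sum_(m \in [set: 'X_{1..c}]%classic)
  uniform_prob (tilings a b c) (fun T => g T == m) *: \prod_(i < c) 'X_i ^+ m i
   :> {mpoly rat[c]}).
  apply: eq_fsbigr => m _; congr (_ *: _).
  rewrite /uniform_prob; congr (_%:R / _); apply: eq_card => T; rewrite !inE.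
  by congr andb; apply/forallP/eqP => [H|<- i];
    [apply/mnmP => i; rewrite mnmE (eqP (H i))|rewrite mnmE].
rewrite fsbig_uniform_prob; congr (_ *: _); apply: eq_bigr => T _.
apply: eq_bigr => i _; rewrite mnmE; congr (_ ^+ _).
by rewrite (nth_map i) ?size_enum_ord // nth_ord_enum.
Qed.
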